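(* The algorithm FreeGBasis (described in the context) is correct: if $H$ is a basis (generating set) of an ideal $I\subset F$ and the algorithm FreeGBasis terminates on input $H$, then its output $\varphi(\bar\iota^{-1}(G))$ is a Gröbner basis of $I$.
   Context: $K$ is a field, $X=\{x_1,x_2,\ldots\}$ a finite or countable set of variables, $F=K\langle X\rangle$, $t$ a new variable, $\bar X=X\cup\{t\}$, $\bar F=K\langle\bar X\rangle$ (free associative algebras; ideals are two-sided; grading by total degree with all variables of degree 1). $\varphi:\bar F\to\bar F$ is the algebra endomorphism $x_i\mapsto x_i$, $t\mapsto1$, with image $F$. For $0\ne f\in F$ with homogeneous components $f=\sum_k f_k$ and $d$ the largest $k$ with $f_k\neq0$, put $f^*=\sum_k f_kt^{d-k}\in\bar F$; $H^*=\{f^*\mid f\in H,f\ne0\}$. $[t,x_i]=tx_i-x_it$. $\mathbb N=\{0,1,\ldots\}$, $\mathbb N^*=\mathbb N\setminus\{0\}$. $P=K[X\times\mathbb N^*]\subset\bar P=K[\bar X\times\mathbb N^*]$ are commutative polynomial algebras with variables $x_i(j)$, $t(j)$; $\mathbb N$ acts by algebra endomorphisms $k\cdot x_i(j)=x_i(k+j)$, $k\cdot t(j)=t(k+j)$; $\mathbb N\cdot G=\{k\cdot g\mid k\in\mathbb N,g\in G\}$. $\bar\iota:\bar F\to\bar P$ is the $K$-linear embedding $y_1\cdots y_d\mapsto y_1(1)\cdots y_d(d)$ ($y_k\in\bar X$); $\bar V_d$ is the image of the degree-$d$ component; $\bar L=\bigcup_d\bar V_d$. The multidegree of a monomial is $\mu=(\mu_k)_{k\ge1}$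 with $\mu_k$ the number of its variables (with multiplicity) of place index $k$. $\psi:\bar P\to\bar P$ is the algebra endomorphism $x_i(j)\mapsto x_i(j)$, $t(j)\mapsto1$, with image $P$. For $0\neq f=\sum_\mu f_\mu\in P$ (multihomogeneous components), $f^*=\sum_\mu f_\mu\prod_kt(k)^{\nu_k-\mu_k}$ with $\nu_k=\max_\mu\{\mu_k\}$ over $\mu$ with $f_\mu\ne0$. Orderings: $\bar P$ has the place $\mathbb N$-ordering induced by a monomial ordering $\prec$ of $\bar P(1)=K[t(1),x_i(1)\mid i\ge1]$ with $t(1)\prec x_1(1)\prec x_2(1)\prec\cdots$: transport $\prec$ by the shift to each $\bar P(j)=K[t(j),x_i(j)\mid i\ge1]$, and compare monomials $m=m_{j_1}\cdots m_{j_k}$, $n=n_{j_1}\cdots n_{j_k}$ ($j_1>\cdots>j_k$, $m_{j_s},n_{j_s}$ possibly trivial monomials of $\bar P(j_s)$) by $m\prec n$ iff for some $r$, $m_{j_s}=n_{j_s}$ for $s<r$ and $m_{j_r}\prec n_{j_r}$. $F$ has the induced ordering, namely the graded right lexicographic ordering with $x_1\prec x_2\prec\cdots$ (compare degree first, then words of equal length at the rightmost position where they differ). $\mathrm{lm},\mathrm{lc}$, $\mathrm{lt}=\mathrm{lc}\cdot\mathrm{lm}$ denote leading monomial, coefficient, term; $\mathrm{LM}(G)$ is the ideal generated by the leading monomials of the nonzero elements of $G$; $\mathrm{spoly}(f,g)=\frac{l}{\mathrm{lt}(f)}f-\frac{l}{\mathrm{lt}(g)}g$ with $l=\mathrm{lcm}(\mathrm{lm}(f),\mathrm{lm}(g))$.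 A Gröbner basis of an ideal $I\subset F$ is a subset $G\subset I$ such that for every $0\ne f\in I$ one has $\mathrm{lm}(f)=u\,\mathrm{lm}(g)\,v$ for some $0\neq g\in G$ and monomials $u,v$ of $F$. $\mathrm{Reduce}(f,G)$ for $f\in\bar P$, $G\subset\bar P$: set $h:=f$; while $h\ne0$ and $\mathrm{lm}(h)\in\mathrm{LM}(G)$, choose $0\neq g\in G$ with $\mathrm{lm}(g)$ dividing $\mathrm{lm}(h)$ and set $h:=h-(\mathrm{lt}(h)/\mathrm{lt}(g))g$; return $h$. Algorithm FreeGBasis. Input: $H$, a basis (generating set) of an ideal $I\subset F$. 1. $G:=\bar\iota(H^*\cup\{[t,x_i]\mid i\ge1\})$; $B:=\{(f,g)\mid f,g\in G\}$. 2. While $B\ne\emptyset$: choose $(f,g)\in B$; $B:=B\setminus\{(f,g)\}$; for all $i\ge0$ such that $\gcd(\mathrm{lm}(f),\mathrm{lm}(i\cdot g))\ne1$ and $\mathrm{lcm}(\mathrm{lm}(f),\mathrm{lm}(i\cdot g))\in\bar L$, do: $h:=\mathrm{Reduce}(\mathrm{spoly}(f,i\cdot g),\mathbb N\cdot G)$; if $h\ne0$ then set $h:=\psi(h)^*$, $B:=B\cup\{(h,h),(h,k),(k,h)\mid k\in G\}$, $G:=G\cup\{h\}$. 3. Return $\varphi(\bar\iota^{-1}(G))$. *)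

(* Defs.v *)
From HB Require Import structures.
From mathcomp Require Import all_boot all_order all_algebra.
From mathcomp Require Import finmap.
From mathcomp.multinomials Require Import monalg.
From mathcomp Require Import boolp classical_sets.

Set Implicit Arguments.
Unset Strict Implicit.
Unset Printing Implicit Defensive.

Import GRing.Theory.
Local Open Scope classical_set_scope.
Local Open Scope ring_scope.

Definition ideal (R : nzRingType) (I : set R) : Prop :=
  [/\ I 0, forall x y, I x -> I y -> I (x + y)
    & forall a x b, I x -> I (a * x * b)].

Definition ideal_gen (R : nzRingType) (S : set R) : set R :=
  [set x | forall J : set R, ideal J -> S `<=` J -> J x].

Definition monomial_ordering (M : monomType) (lt : M -> M -> Prop) : Prop :=
  [/\ (forall m, ~ lt m m),
      (forall m n p, lt m n -> lt n p -> lt m p),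
      (forall m n, m <> n -> lt m n \/ lt n m),
      (forall m n p q, lt m n -> lt (mmul (mmul p m) q) (mmul (mmul p n) q))
    & well_founded lt].

Section Leading.
Variables (K : fieldType) (M : monomType) (lt : M -> M -> Prop).

(* Junk value [mone] when [f = 0]. *)
Definition lm (f : {malg K[M]}) : M :=
  xget mone [set m | m \in msupp f /\
                     forall n, n \in msupp f -> n <> m -> lt n m].

Definition lc (f : {malg K[M]}) : K := f@_(lm f).

Definition LM (G : set {malg K[M]}) : set {malg K[M]} :=
  ideal_gen [set << lm g >> | g in [set g | G g /\ g <> 0]].

Definition groebner_basis (I G : set {malg K[M]}) : Prop :=
  G `<=` I /\
  forall f, I f -> f <> 0 ->
    exists2 g, G g /\ g <> 0 &
      exists u v : M, lm f = mmul (mmul u (lm g)) v.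
End Leading.

Section Cmonom.
Variable V : choiceType.
Implicit Types m n : {cmonom V}.

Definition dvdcm m n : Prop := exists q, n = mmul m q.
Definition lcmcm m n : {cmonom V} :=
  [cmonom maxn (m v) (n v) | v in (finsupp m `|` finsupp n)%fset]%M.
Definition gcdcm m n : {cmonom V} :=
  [cmonom minn (m v) (n v) | v in (finsupp m `|` finsupp n)%fset]%M.
End Cmonom.

Section Reduce.
Variables (K : fieldType) (V : choiceType).
Variable lt : {cmonom V} -> {cmonom V} -> Prop.
Local Notation lm := (lm lt).
Local Notation lc := (lc lt).
Implicit Types (f g h r : {malg K[{cmonom V}]}).

Definition spoly f g : {malg K[{cmonom V}]} :=
  let l := lcmcm (lm f) (lm g) in
  << (lc f)^-1 *g divcm l (lm f) >> * f - << (lc g)^-1 *g divcm l (lm g) >> * g.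

(* [Reduce S f r]: some run of the (non-deterministic) procedure on the input
   [(f, S)] returns [r]. *)
Inductive Reduce (S : set {malg K[{cmonom V}]}) :
    {malg K[{cmonom V}]} -> {malg K[{cmonom V}]} -> Prop :=
| Reduce_stop h :
    ~ (h <> 0 /\ LM lt S << lm h >>) -> Reduce S h h
| Reduce_step h g r :
    h <> 0 -> LM lt S << lm h >> ->
    S g -> g <> 0 -> dvdcm (lm g) (lm h) ->
    Reduce S (h - << lc h / lc g *g divcm (lm h) (lm g) >> * g) r ->
    Reduce S h r.
End Reduce.

(* The index set of X: {0, ..., n-1} for [Some n], all of nat for [None];
   the index i stands for the variable x_(i+1). *)
Definition is_xindex (N : option nat) (i : nat) : bool :=
  if N is Some n then (i < n)%N else true.
Definition xvar (N : option nat) := {i : nat | is_xindex N i}.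
HB.instance Definition _ N := Choice.on (xvar N).

(* \bar X : [None] is t, [Some i] is a variable of X. *)
Definition xtvar (N : option nat) := option (xvar N).
HB.instance Definition _ N := Choice.on (xtvar N).

Notation "''F' [ K , N ]" := {malg K[{fmonom (xvar N)}]}
  (at level 8, format "''F' [ K ,  N ]") : type_scope.
Notation "''Fbar' [ K , N ]" := {malg K[{fmonom (xtvar N)}]}
  (at level 8, format "''Fbar' [ K ,  N ]") : type_scope.
(* The place indices 1, 2, 3, ... are represented by 0, 1, 2, ...: the pair
   (y, j) stands for the variable y(j+1). *)
Notation "''Pbar' [ K , N ]" := {malg K[{cmonom (xtvar N * nat)%type}]}
  (at level 8, format "''Pbar' [ K ,  N ]") : type_scope.

Section Letterplace.
Variables (K : fieldType) (N : option nat).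
Local Notation F := 'F[K, N].
Local Notation Fbar := 'Fbar[K, N].
Local Notation Pbar := 'Pbar[K, N].
Local Notation place_mon := {cmonom (xtvar N * nat)%type}.

(* The part of [m] in \bar P(j), transported to \bar P(1). *)
Definition place_part (m : place_mon) (j : nat) : {cmonom xtvar N} :=
  [cmonom m (y, j) | y in [fset p.1 | p in finsupp m]%fset]%M.

Definition place_lt (lt : {cmonom xtvar N} -> {cmonom xtvar N} -> Prop)
    (m n : place_mon) : Prop :=
  exists j, (forall k, (j < k)%N -> place_part m k = place_part n k) /\
            lt (place_part m j) (place_part n j).

Definition ordered_variables
    (lt : {cmonom xtvar N} -> {cmonom xtvar N} -> Prop) : Prop :=
  (forall i : xvar N, lt (ucm None) (ucm (Some i))) /\
  (forall i j : xvar N, (val i < val j)%N -> lt (ucm (Some i)) (ucm (Some j))).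

Definition grrlex_lt (u v : {fmonom (xvar N)}) : Prop :=
  (fdeg u < fdeg v)%N \/
  fdeg u = fdeg v /\
  exists (a b c : seq (xvar N)) (x y : xvar N),
    [/\ u = a ++ x :: c :> seq _, v = b ++ y :: c :> seq _,
        size a = size b & (val x < val y)%N].

Definition falg_eval (I : choiceType) (R : nzRingType) (c : K -> R) (h : I -> R)
    (f : {malg K[{fmonom I}]}) : R :=
  mmap c (fun w : {fmonom I} => \prod_(y <- (w : seq I)) h y) f.

Definition xF (i : xvar N) : F := << fmu i >>.
Definition yFbar (y : xtvar N) : Fbar := << fmu y >>.
Definition tFbar : Fbar := yFbar None.

Definition phi : Fbar -> F :=
  falg_eval malgC (fun y => if y is Some i then xF i else 1).

Definition inclF : F -> Fbar := falg_eval malgC (fun i => yFbar (Some i)).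

Definition hcomp (k : nat) (f : F) : F :=
  \sum_(w <- msupp f | fdeg w == k) << f@_w *g w >>.

Definition topdeg (f : F) : nat := \max_(w <- msupp f) fdeg w.

Definition homog (f : F) : Fbar :=
  \sum_(k < (topdeg f).+1) inclF (hcomp k f) * tFbar ^+ (topdeg f - k).

Definition homog_set (H : set F) : set Fbar :=
  [set homog f | f in [set f | H f /\ f <> 0]].

Definition t_commutators : set Fbar :=
  [set tFbar * yFbar (Some i) - yFbar (Some i) * tFbar | i in [set: xvar N]].

Definition letterplace_mon (w : {fmonom (xtvar N)}) : place_mon :=
  \big[mmul/mone]_(p <- zip w (seq.iota 0 (size w))) ucm p.

Definition letterplace (f : Fbar) : Pbar :=
  \sum_(w <- msupp f) << f@_w *g letterplace_mon w >>.

Definition Vbar (d : nat) : set Pbar :=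
  [set letterplace f |
    f in [set f : Fbar | forall w, w \in msupp f -> fdeg w = d]].

Definition Lbar : set Pbar := \bigcup_d Vbar d.

Definition yPbar (p : xtvar N * nat) : Pbar := << ucm p >>.

Definition Pbar_endo (h : xtvar N * nat -> Pbar) : Pbar -> Pbar :=
  mmap malgC (fun m : place_mon => \prod_(p <- finsupp m) h p ^+ m p).

Definition shift (k : nat) : Pbar -> Pbar :=
  Pbar_endo (fun p => yPbar (p.1, (k + p.2)%N)).

Definition shift_set (G : set Pbar) : set Pbar :=
  [set f | exists k, exists2 g, G g & f = shift k g].

Definition psi : Pbar -> Pbar :=
  Pbar_endo (fun p => if p.1 is Some _ then yPbar p else 1).

Definition multideg (m : place_mon) (k : nat) : nat := mdeg (place_part m k).

Definition max_multideg (f : Pbar) (k : nat) : nat :=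
  \max_(m <- msupp f) multideg m k.

Definition places (f : Pbar) : {fset nat} :=
  [fset p.2 | m in msupp f, p in finsupp (m : place_mon)]%fset.

(* The power of t(1), t(2), ... depends only on the multidegree of a monomial,
   so the sum over multihomogeneous components is expanded into a sum over the
   monomials of [f]; outside [places f] all exponents vanish. *)
Definition multihomog (f : Pbar) : Pbar :=
  \sum_(m <- msupp f) << f@_m *g m >> *
    \prod_(k <- places f) yPbar (None, k) ^+ (max_multideg f k - multideg m k).

Section Algorithm.
Variable lt : {cmonom xtvar N} -> {cmonom xtvar N} -> Prop.
Local Notation lmP := (lm (place_lt lt)).
Local Notation state := (set Pbar * set (Pbar * Pbar))%type.

Definition init_G (H : set F) : set Pbar :=
  letterplace @` (homog_set H `|` t_commutators).

Definition init (H : set F) : state :=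
  (init_G H, [set p | init_G H p.1 /\ init_G H p.2]).

Definition critical (f g : Pbar) (i : nat) : Prop :=
  gcdcm (lmP f) (lmP (shift i g)) <> mone /\
  Lbar << lcmcm (lmP f) (lmP (shift i g)) >>.

Definition add_element (h : Pbar) (s : state) : state :=
  (s.1 `|` [set h],
   s.2 `|` ([set (h, h)] `|` [set (h, k) | k in s.1]
                         `|` [set (k, h) | k in s.1])).

Inductive treat (f g : Pbar) (i : nat) (s : state) : state -> Prop :=
| treat_zero :
    Reduce (place_lt lt) (shift_set s.1) (spoly (place_lt lt) f (shift i g)) 0 ->
    treat f g i s s
| treat_nonzero h :
    Reduce (place_lt lt) (shift_set s.1) (spoly (place_lt lt) f (shift i g)) h ->
    h <> 0 ->
    treat f g i s (add_element (multihomog (psi h)) s).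

Inductive treat_all (f g : Pbar) : seq nat -> state -> state -> Prop :=
| treat_all_nil s : treat_all f g [::] s s
| treat_all_cons i l s1 s2 s3 :
    treat f g i s1 s2 -> treat_all f g l s2 s3 ->
    treat_all f g (i :: l) s1 s3.

(* [main_loop s G]: some terminating run of the while loop from the state [s]
   ends with the set [G]. The critical shifts of a pair are enumerated in an
   arbitrary order. *)
Inductive main_loop : state -> set Pbar -> Prop :=
| main_loop_stop G : main_loop (G, set0) G
| main_loop_step G B f g l s G' :
    B (f, g) ->
    uniq l -> (forall i, i \in l <-> critical f g i) ->
    treat_all f g l (G, B `\ (f, g)) s ->
    main_loop s G' ->
    main_loop (G, B) G'.

(* [FreeGBasis H O]: some run of the algorithm on the input [H] terminates with
   the output [O]. *)
Definition FreeGBasis (H : set F) (O : set F) : Prop :=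
  exists2 G, main_loop (init H) G & O = phi @` (letterplace @^-1` G).
End Algorithm.
End Letterplace.

(* Main.v *)
Require Import Defs.
From HB Require Import structures.
From mathcomp Require Import all_boot all_order all_algebra.
From mathcomp Require Import finmap.
From mathcomp.multinomials Require Import monalg.
From mathcomp Require Import boolp classical_sets.
From mathcomp Require Import zify.

Set Implicit Arguments.
Unset Strict Implicit.
Unset Printing Implicit Defensive.
Import GRing.Theory.

(** The algorithm is Buchberger's algorithm in the free algebra generated by X
and t, seen through the letterplace embedding: a word w of length d is the
multilinear monomial [pword 0 w], whose letters occupy the places 0, ..., d-1,
and the multiples of a shift [shift k g] that stay multilinear of degree d are
the letterplace images of the products u g v. Three facts make the output a
Groebner basis.

The pairs treated by the algorithm are exactly the overlaps and inclusions of
leading words. Gcd of [lm f] and [lm (shift i g)] different from 1 says that the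
two words share a place; lcm in [Lbar] says that they agree where they meet, so
that the lcm is one word w and the S-polynomial is the letterplace image of
[f v - u g v'] ([critical_words], [critical_overlap], [spoly_lp]). Reduction
subtracts products u g v whose leading words are smaller than w ([Reduce_lp]).
Hence, when no pair is left, each S-polynomial is a combination of products
u g v with leading words smaller than the overlap; since disjoint occurrences
resolve by themselves, the diamond lemma ([diamond]) says that every nonzero
element of the ideal generated by the final set G has a leading word that
contains a leading word of G.

Replacing a remainder h by the homogenization of psi(h) divides it by a power of
t. The commutators t x - x t are in the basis, with leading word t x, so the
leading word of an irreducible remainder is x-letters followed by t^k. As t is
the smallest letter, every smaller word of the same length also ends in t^k;
setting t = 1 and restoring t in the empty places thus removes the common
factor t^k and nothing else ([rehomogenize]). Every element of G other than a
commutator therefore has a leading word without t, and remains mapped into I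
by phi.

Finally, modulo the commutators t is central, so for f in I and D large the
degree-D homogenization of f is in the ideal generated by G ([homogenizes_in],
an ideal of F that contains H). Its leading word is [lm f] followed by a power
of t, so some leading word of G occurs in it; that word is not t x, hence it has
no t, and it is the leading word of the corresponding element of phi(G)
([lm_phi]). Erasing t from the factorization gives the divisibility in F. *)

(** * Linear maps induced by maps of monomials *)

Lemma mul_sum_both (R : nzRingType) (I J : Type) (r : seq I) (s : seq J)
    (E : I -> R) (f : R) (E' : J -> R) :
  ((\sum_(i <- r) E i) * f * (\sum_(j <- s) E' j) =
   \sum_(i <- r) \sum_(j <- s) E i * f * E' j)%R.
Proof.
by rewrite !mulr_suml; apply: eq_bigr => i _; rewrite mulr_sumr.
Qed.

(** The letterplace embedding, phi, the homogenizations and the two-sided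
multiplication by words are all linear extensions of maps of monomials, and so
are the shifts and psi on letterplace images; identities between them reduce to
identities between maps of monomials. *)
HB.lock Definition relabel (K : fieldType) (M M' : choiceType) (s : M -> M')
    (f : {malg K[M]}) : {malg K[M']} :=
  (\sum_(m <- msupp f) << f@_m *g s m >>)%R.

Section Relabel.
Local Open Scope ring_scope.
Variable K : fieldType.

Section Basic.
Variables (M M' : choiceType) (s : M -> M').
Implicit Types f g : {malg K[M]}.

Lemma relabelEw (d : {fset M}) f : (msupp f `<=` d)%fset ->
  relabel s f = \sum_(m <- d) << f@_m *g s m >>.
Proof.
move=> le; rewrite relabel.unlock (big_fset_incl _ le) // => m _ mf.
by rewrite mcoeff_outdom // monalgU0.
Qed.

Lemma relabelD f g : relabel s (f + g) = relabel s f + relabel s g.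
Proof.
have := msuppD_le f g; set d := (_ `|` _)%fset => led.
rewrite (relabelEw led) (@relabelEw d f) ?fsubsetUl //.
rewrite (@relabelEw d g) ?fsubsetUr // -big_split /=.
by apply: eq_bigr => m _; rewrite mcoeffD monalgUD.
Qed.

Lemma relabelZ c f : relabel s (c *: f) = c *: relabel s f.
Proof.
rewrite (relabelEw (msuppZ_le c f)) relabel.unlock scaler_sumr; apply: eq_bigr => m _.
by apply/malgP => k; rewrite !(mcoeffZ, mcoeffU) mulrnAr.
Qed.

Lemma relabel0 : relabel s (0 : {malg K[M]}) = 0.
Proof. by rewrite relabel.unlock msupp0 big_seq_fset0. Qed.

Lemma relabelN f : relabel s (- f) = - relabel s f.
Proof. by rewrite -scaleN1r relabelZ scaleN1r. Qed.

Lemma relabelB f g : relabel s (f - g) = relabel s f - relabel s g.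
Proof. by rewrite relabelD relabelN. Qed.

Lemma relabel_sum (I : Type) (r : seq I) (P : pred I) (F : I -> {malg K[M]}) :
  relabel s (\sum_(i <- r | P i) F i) = \sum_(i <- r | P i) relabel s (F i).
Proof. exact: (big_morph _ relabelD relabel0). Qed.

Lemma relabelU (c : K) m : relabel s << c *g m >> = << c *g s m >>.
Proof.
by rewrite (relabelEw msuppU_le) big_seq_fset1 mcoeffUU.
Qed.

Lemma msupp_relabel f n : n \in msupp (relabel s f) ->
  exists2 m, m \in msupp f & n = s m.
Proof.
move=> nf; apply: contrapT => hn; move: nf; rewrite -mcoeff_neq0 => /negP; apply.
rewrite relabel.unlock (raddf_sum (mcoeff n)) big_seq big1 // => m mf /=.
rewrite mcoeffU; case: eqP => // sm; case: hn; by exists m.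
Qed.

(** Only the fibre of [s m] has to be trivial: erasing t is far from
injective on words, but it is injective at the words used below. *)
Lemma mcoeff_relabel f m :
  (forall n, n \in msupp f -> s n = s m -> n = m) -> (relabel s f)@_(s m) = f@_m.
Proof.
move=> inj; have le : (msupp f `<=` m |` msupp f)%fset by rewrite fsubsetUr.
rewrite (relabelEw le) (raddf_sum (mcoeff (s m))).
rewrite (bigD1_seq m) ?fset1U1 ?fset_uniq //=.
rewrite mcoeffUU big_seq_cond big1 ?addr0 // => n /andP[+ nm].
rewrite in_fset1U (negPf nm) /= => nf; rewrite mcoeffU; case: eqP => // e.
by move: nm; rewrite (inj _ nf e) eqxx.
Qed.

Lemma eq_relabel (s' : M -> M') f : {in msupp f, s =1 s'} ->
  relabel s f = relabel s' f.
Proof. by move=> e; rewrite relabel.unlock; apply: eq_big_seq => m mf; rewrite e. Qed.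

Lemma relabel_diff (s' : M -> M') f :
  relabel s f - relabel s' f = \sum_(m <- msupp f) f@_m *: (<< s m >> - << s' m >>).
Proof.
rewrite relabel.unlock -sumrB; apply: eq_bigr => m _.
by apply/malgP => k; rewrite mcoeffZ !mcoeffB !mcoeffU mulrBr !mulrnAr mulr1.
Qed.

Lemma relabelUB (m n : M) :
  relabel s (<< m >> - << n >> : {malg K[M]}) = << s m >> - << s n >>.
Proof. by rewrite relabelB !relabelU. Qed.

Lemma mcoeffUB (m n : M) : m <> n -> (<< m >> - << n >> : {malg K[M]})@_m = 1.
Proof. by move=> /eqP mn; rewrite mcoeffB !mcoeffU eqxx eq_sym (negPf mn) subr0. Qed.
End Basic.

Lemma relabel_id (M : choiceType) (s : M -> M) (f : {malg K[M]}) :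
  {in msupp f, s =1 id} -> relabel s f = f.
Proof.
move=> e; rewrite relabel.unlock [RHS]monalgE.
by apply: eq_big_seq => m /e ->.
Qed.

Lemma relabel_comp (M M' M'' : choiceType) (s : M -> M') (s' : M' -> M'')
    (f : {malg K[M]}) :
  relabel s' (relabel s f) = relabel (s' \o s) f.
Proof.
have -> : relabel s f = \sum_(m <- msupp f) << f@_m *g s m >>.
  by rewrite relabel.unlock.
rewrite relabel_sum [in RHS]relabel.unlock.
by apply: eq_bigr => m _; rewrite relabelU.
Qed.

Lemma mulUU (M : monomType) c d (m n : M) :
  << c *g m >> * << d *g n >> = << c * d *g mmul m n >> :> {malg K[M]}.
Proof. by rewrite malgM_def fgmulUU. Qed.

Lemma mulUUU (M : monomType) c (p m q : M) :
  << p >> * << c *g m >> * << q >> = << c *g mmul (mmul p m) q >> :> {malg K[M]}.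
Proof. by rewrite !mulUU mul1r mulr1. Qed.

Lemma mulU_relabel (M : monomType) c (m : M) (f : {malg K[M]}) :
  << c *g m >> * f = c *: relabel (mmul m) f.
Proof.
have -> : << c *g m >> * f = << c *g m >> * relabel id f by rewrite relabel_id.
rewrite !relabel.unlock mulr_sumr scaler_sumr; apply: eq_bigr => n _.
by rewrite mulUU; apply/malgP => k; rewrite !(mcoeffZ, mcoeffU) mulrnAr.
Qed.

Definition sandwich (M : monomType) (u v : M) (f : {malg K[M]}) : {malg K[M]} :=
  relabel (fun w => mmul (mmul u w) v) f.

Lemma mulU_sandwich (M : monomType) c d (u v : M) (f : {malg K[M]}) :
  << c *g u >> * f * << d *g v >> = (c * d) *: sandwich u v f.
Proof.
have -> : << c *g u >> * f * << d *g v >> = << c *g u >> * relabel id f * << d *g v >>.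
  by rewrite relabel_id.
rewrite /sandwich !relabel.unlock mulr_sumr mulr_suml scaler_sumr.
apply: eq_bigr => n _; rewrite !mulUU; apply/malgP => k.
by rewrite mcoeffZ !mcoeffU mulrnAr mulrAC.
Qed.

Lemma mul_sandwich_sum (M : monomType) (a f b : {malg K[M]}) :
  a * f * b = \sum_(u <- msupp a) \sum_(v <- msupp b)
    (a@_u * b@_v) *: sandwich u v f.
Proof.
transitivity ((\sum_(u <- msupp a) << a@_u *g u >>) * f *
    (\sum_(v <- msupp b) << b@_v *g v >>)); first by rewrite -!monalgE.
rewrite mul_sum_both; apply: eq_bigr => u _; apply: eq_bigr => v _.
exact: mulU_sandwich.
Qed.

Lemma mulU_sandwichl (M : monomType) c (p m q v : M) (f : {malg K[M]}) :
  << p >> * << c *g m >> * << q >> * f * << v >> =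
  c *: sandwich (mmul (mmul p m) q) v f.
Proof. by rewrite -[c in RHS]mulr1 -mulU_sandwich -mulUUU. Qed.

Lemma mulU_sandwichr (M : monomType) c (u p m q : M) (f : {malg K[M]}) :
  << u >> * f * (<< p >> * << c *g m >> * << q >>) =
  c *: sandwich u (mmul (mmul p m) q) f.
Proof. by rewrite -[c in RHS]mul1r -mulU_sandwich -mulUUU. Qed.

Lemma sandwichE (M : monomType) (u v : M) (f : {malg K[M]}) :
  sandwich u v f = << u >> * f * << v >>.
Proof. by rewrite mulU_sandwich mulr1 scale1r. Qed.

Lemma sandwichZ (M : monomType) c (u v : M) (f : {malg K[M]}) :
  sandwich u v (c *: f) = c *: sandwich u v f.
Proof. exact: relabelZ. Qed.

Lemma sandwichD (M : monomType) (u v : M) (f g : {malg K[M]}) :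
  sandwich u v (f + g) = sandwich u v f + sandwich u v g.
Proof. exact: relabelD. Qed.

Lemma sandwichB (M : monomType) (u v : M) (f g : {malg K[M]}) :
  sandwich u v (f - g) = sandwich u v f - sandwich u v g.
Proof. exact: relabelB. Qed.

End Relabel.

(** * Leading monomials and the graded right lexicographic ordering *)

Section LeadingMonomials.
Local Open Scope ring_scope.
Variables (K : fieldType) (M : monomType) (lt : M -> M -> Prop).
Implicit Type f : {malg K[M]}.

Lemma lm_unique f m : (forall p q, lt p q -> ~ lt q p) -> m \in msupp f ->
  (forall n, n \in msupp f -> n <> m -> lt n m) -> lm lt f = m.
Proof.
move=> asym mf mmax; rewrite /lm; case: xgetP => [p _ [pf pmax]|/(_ m)] /=.
  apply: contrapT => ne; apply: (asym _ _ (pmax m mf _) (mmax p pf ne)).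
  by move=> e; apply: ne.
by case; split.
Qed.

Lemma lm_spec f : (forall p q r, lt p q -> lt q r -> lt p r) ->
  (forall p q, p <> q -> lt p q \/ lt q p) -> f <> 0 ->
  lm lt f \in msupp f /\
  forall n, n \in msupp f -> n <> lm lt f -> lt n (lm lt f).
Proof.
move=> tr tot f0; suff [m mP] : exists m, m \in msupp f /\
    forall n, n \in msupp f -> n <> m -> lt n m.
  exact: (@xgetPex _ mone (fun m => m \in msupp f /\
    forall n, n \in msupp f -> n <> m -> lt n m) (ex_intro _ m mP)).
have [m0 m0f] : exists m, m \in msupp f.
  apply: contrapT => no; apply: f0; apply/eqP; rewrite -msupp_eq0.
  by apply/eqP/fsetP => m; rewrite inE; apply/negP => mf; apply: no; exists m.
have max_seq (s : seq M) a : exists m, m \in a :: s /\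
    forall n, n \in a :: s -> n <> m -> lt n m.
  elim: s a => [|b s IH] a.
    by exists a; rewrite inE eqxx; split=> // n; rewrite inE => /eqP.
  have [m [ms mmax]] := IH b; have [e|/eqP ne] := eqVneq a m.
    exists m; rewrite inE ms orbT; split=> // n.
    by rewrite inE e => /orP[/eqP->|/mmax].
  case: (tot _ _ ne) => h.
    exists m; rewrite inE ms orbT; split=> // n.
    by rewrite inE => /orP[/eqP->|/mmax].
  exists a; rewrite inE eqxx; split=> // n.
  rewrite inE => /orP[/eqP->|ns] // _; have [->//|/eqP nm] := eqVneq n m.
  exact: tr (mmax _ ns nm) h.
have [m [ms mmax]] := max_seq (msupp f) m0; exists m; split.
  by move: ms; rewrite inE => /orP[/eqP->|].
by move=> n nf; apply: mmax; rewrite inE nf orbT.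
Qed.
End LeadingMonomials.

Section WordOrder.
Variables (A : choiceType) (rank : A -> nat).
Hypothesis rank_inj : injective rank.
Implicit Types u v w p q : {fmonom A}.

(** Words are compared through the ranks of their letters. The default rank 0
beyond the end of a word is harmless, as only words of equal length are compared
this way. *)
Definition rlex (s t : seq nat) : Prop :=
  exists j, (forall k, (j < k)%N -> nth 0%N s k = nth 0%N t k) /\
            (nth 0%N s j < nth 0%N t j)%N.

Definition deg_rlex u v : Prop := (size u < size v)%N \/
  size u = size v /\ rlex (map rank u) (map rank v).

Lemma rlex_trans s t r : rlex s t -> rlex t r -> rlex s r.
Proof.
move=> [i [ie il]] [j [je jl]]; case: (ltngtP i j) => ij.
- exists j; split=> [k jk|]; last by rewrite ie.
  by rewrite ie ?je //; apply: ltn_trans jk.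
- exists i; split=> [k ik|]; last by rewrite -je.
  by rewrite ie ?je //; apply: ltn_trans ik.
- subst j; exists i; split=> [k ik|]; first by rewrite ie ?je.
  exact: ltn_trans jl.
Qed.

Lemma rlex_irr s : ~ rlex s s.
Proof. by case=> j [_]; rewrite ltnn. Qed.

Lemma rlex_total s t : size s = size t -> s <> t -> rlex s t \/ rlex t s.
Proof.
move=> st ne; pose P k := nth 0%N s k != nth 0%N t k.
have exP : exists k, P k.
  apply: contrapT => no; apply: ne; apply: (@eq_from_nth _ 0%N) => // k _.
  by apply/eqP/negPn/negP => h; apply: no; exists k.
have ub k : P k -> (k <= size s)%N.
  by rewrite leqNgt; apply: contra => h; rewrite !nth_default -?st ?(ltnW h).
case: (ex_maxnP exP ub) => j Pj jmax.
have eq k : (j < k)%N -> nth 0%N s k = nth 0%N t k.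
  by rewrite ltnNge => h; apply/eqP/negPn; apply: contra h; apply: jmax.
case: (ltngtP (nth 0%N s j) (nth 0%N t j)) => h.
- by left; exists j.
- by right; exists j; split=> // k /eq.
- by move: Pj; rewrite /P h eqxx.
Qed.

Lemma deg_rlex_trans u v w : deg_rlex u v -> deg_rlex v w -> deg_rlex u w.
Proof.
move=> [uv|[uv ruv]] [vw|[vw rvw]].
- by left; apply: ltn_trans vw.
- by left; rewrite -vw.
- by left; rewrite uv.
- by right; rewrite uv; split=> //; apply: rlex_trans rvw.
Qed.

Lemma deg_rlex_irr u : ~ deg_rlex u u.
Proof. by case=> [|[_ /rlex_irr//]]; rewrite ltnn. Qed.

Lemma deg_rlex_total u v : u <> v -> deg_rlex u v \/ deg_rlex v u.
Proof.
move=> ne; case: (ltngtP (size u) (size v)) => h; [by left; left|by right; left|].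
have : map rank u <> map rank v.
  by move=> /(inj_map rank_inj) e; apply: ne; apply/eqP; rewrite fmP e.
by case/(rlex_total _) => [|r|r]; rewrite ?size_map //; [left|right]; right.
Qed.

Lemma deg_rlex_mul p q u v : deg_rlex u v ->
  deg_rlex (mmul (mmul p u) q) (mmul (mmul p v) q).
Proof.
rewrite /deg_rlex !fmM !size_cat !ltn_add2r !ltn_add2l; case=> [uv|[uv [j [je jl]]]].
  by left.
right; split; first by rewrite uv.
have ju : (j < size u)%N.
  rewrite ltnNge; apply/negP => h.
  by move: jl; rewrite !nth_default ?size_map -?uv.
exists (size p + j)%N; rewrite !map_cat -!catA; split=> [k kj|]; last first.
  by rewrite !nth_cat !size_map (ltnNge _ (size p)) leq_addr addKn -uv ju.
rewrite !nth_cat !size_map -uv; case: ltnP => // pk; case: ltnP => // ku.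
by apply: je; lia.
Qed.

(** On words of a fixed length n.+1 the ordering is the lexicographic product of
the rank of the last letter with the ordering on the first n letters; the
lengths are compared before that. *)
Lemma deg_rlex_wf : well_founded deg_rlex.
Proof.
pose R n (s t : seq nat) := size s = n /\ rlex s t.
have accR n s : size s = n -> Acc (R n) s.
  elim: n s => [|n IH] s.
    move/size0nil => ->; constructor=> t [t0 [j [_]]].
    by rewrite nth_nil ltn0.
  case/lastP: s => [//|s x].
  rewrite size_rcons.
  move=> [sn].
  elim/ltn_ind: x s sn => x IHx s sn.
  elim: (IH s sn) (sn) => {sn}s _ IHs sn.
  constructor=> t [tn [j [je jl]]].
  case/lastP: t tn je jl => [tn|t y]; first by discriminate tn.
  rewrite size_rcons => -[tn] je jl.
  have jn : (j <= n)%N.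
    by rewrite leqNgt; apply/negP => h; move: jl; rewrite !nth_rcons sn; case: ltngtP h.
  have [{}jn|e] : (j < n)%N \/ j = n by case: ltngtP jn => // h _; [left|right].
    have xy : y = x.
      by have := je _ jn; rewrite !nth_rcons sn tn ltnn eqxx.
    rewrite xy; apply: IHs => //; split=> //; exists j; split=> [k jk|].
      have := je _ jk; rewrite !nth_rcons sn tn; case: (ltngtP k n) => // [h _|->].
        by rewrite !nth_default ?sn ?tn ?(ltnW h).
      by rewrite !nth_default ?sn ?tn.
    by move: jl; rewrite !nth_rcons sn tn jn.
  by apply: IHx => //; move: jl; rewrite !nth_rcons sn tn e ltnn eqxx.
suff acc n u : size u = n -> Acc deg_rlex u by move=> u; apply: (acc (size u)).
elim/ltn_ind: n u => n IHn u un.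
have := accR n (map rank u); rewrite size_map => /(_ un).
move es : (map rank u) => s a; elim: a u un es => {}s _ IHs u un es.
constructor=> v [vu|[vu r]]; first by apply: (IHn (size v)); rewrite -?un.
by apply: (IHs (map rank v)) => //; rewrite -?es /R ?size_map vu.
Qed.

Lemma deg_rlex_split (a b c : seq A) (x y : A) : size a = size b ->
  (rank x < rank y)%N -> deg_rlex (FMonom (a ++ x :: c)) (FMonom (b ++ y :: c)).
Proof.
move=> ab xy; right; split; first by rewrite /= !size_cat ab.
exists (size a); rewrite /= !map_cat; split=> [k h|].
  by rewrite !nth_cat !size_map -ab ltnNge (ltnW h) /= -[(k - _)%N]prednK ?subn_gt0.
by rewrite !nth_cat !size_map -ab ltnn subnn.
Qed.

Lemma deg_rlexP u v : size u = size v -> deg_rlex u v ->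
  exists (a b c : seq A) (x y : A), [/\ u = a ++ x :: c :> seq _,
    v = b ++ y :: c :> seq _, size a = size b & (rank x < rank y)%N].
Proof.
move=> uv [|[_ [j [je jl]]]]; first by rewrite uv ltnn.
have ju : (j < size u)%N.
  rewrite ltnNge; apply/negP => h.
  by move: jl; rewrite !nth_default ?size_map -?uv.
have [x0 _] : exists x0 : A, True by case: (u : seq A) ju => // x0; exists x0.
have jv : (j < size v)%N by rewrite -uv.
exists (take j u), (take j v), (drop j.+1 u), (nth x0 u j), (nth x0 v j); split.
- by rewrite -drop_nth // cat_take_drop.
- suff -> : drop j.+1 u = drop j.+1 v by rewrite -drop_nth // cat_take_drop.
  apply: (inj_map rank_inj); rewrite !map_drop; apply: (@eq_from_nth _ 0%N).
    by rewrite !size_drop !size_map uv.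
  by move=> k _; rewrite !nth_drop je // addSn ltnS leq_addr.
- by rewrite !size_take ju jv.
- by move: jl; rewrite !(nth_map x0).
Qed.

End WordOrder.

Lemma grrlex_ltE N : @grrlex_lt N = deg_rlex (fun i : xvar N => val i).
Proof.
apply/funext => u; apply/funext => v; apply/propext; rewrite /grrlex_lt !fdegE.
split=> [[uv|[uv [a [b [c [x [y [ue ve ab xy]]]]]]]]|].
- by left.
- by rewrite -(fmK u) -(fmK v) ue ve; apply: deg_rlex_split.
- move=> h; case: (h) => [|[uv _]]; [by left|right; split=> //].
  exact: (deg_rlexP val_inj).
Qed.

(** * The diamond lemma *)

Section RingIdentities.
Local Open Scope ring_scope.
Variable R : nzRingType.
Implicit Types (a b c d : R).

Lemma mul_sum_mid (I : Type) (s : seq I) (E : I -> R) a b c d :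
  a * (\sum_(i <- s) E i) * b * c * d = \sum_(i <- s) a * E i * b * c * d.
Proof. by rewrite mulr_sumr !mulr_suml. Qed.

Lemma mul_sum_right (I : Type) (s : seq I) (E : I -> R) a b c d :
  a * b * (c * (\sum_(i <- s) E i) * d) = \sum_(i <- s) a * b * (c * E i * d).
Proof. by rewrite mulr_sumr mulr_suml mulr_sumr. Qed.

(** For disjoint occurrences of a and b, the leading monomials of the monic g and
g', the S-polynomial is a combination of multiples of g' by the tail of g and of
g by the tail of g'. *)
Lemma disjoint_identity p g a m g' b x :
  p * g * (m * b * x) - (p * a * m) * g' * x =
  p * (g - a) * m * g' * x - p * g * (m * (g' - b) * x) :> R.
Proof.
rewrite !(mulrBl, mulrBr) !mulrA opprB [RHS]addrC -!addrA; congr (_ + _).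
by rewrite addrA addNr add0r.
Qed.

Lemma combine_top (k : fieldType) (V : lmodType k) (c d a b : k) (s t f : V) :
  b != 0 -> c *: s + (d *: t + f) =
  (c + d * b / a) *: s + (f - (d * b) *: (a^-1 *: s - b^-1 *: t)).
Proof.
move=> b0; rewrite scalerBr !scalerA mulfK // scalerDl -!addrA; congr (_ + _).
by rewrite opprB [RHS]addrC addrA subrK addrC.
Qed.
End RingIdentities.

(** Levi's property: two factorizations of the same element have a common
refinement. It is all that the diamond lemma needs to know about words. *)
Definition equidivisible (M : monomType) : Prop := forall p s p' s' : M,
  mmul p s = mmul p' s' ->
  (exists2 u, p' = mmul p u & s = mmul u s') \/
  (exists2 u, p = mmul p' u & s' = mmul u s).

Section Diamond.
Local Open Scope ring_scope.
Variables (K : fieldType) (M : monomType) (lt : M -> M -> Prop).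
Hypothesis lt_ordering : monomial_ordering lt.
Local Notation F := {malg K[M]}.
Local Notation lmw := (lm lt).
Local Notation lcw := (lc lt).
Local Notation "u · v" := (mmul u v) (at level 40, left associativity).
Implicit Types (f g h r : F) (u v w p q x : M) (G : set F) (P : M -> Prop).

Let lt_irr u : ~ lt u u.
Proof. by case: lt_ordering => h _ _ _ _; apply: h. Qed.

Let lt_trans u v w : lt u v -> lt v w -> lt u w.
Proof. by case: lt_ordering => _ h _ _ _; apply: h. Qed.

Let lt_total u v : u <> v -> lt u v \/ lt v u.
Proof. by case: lt_ordering => _ _ h _ _; apply: h. Qed.

Let lt_mul p q u v : lt u v -> lt (p · u · q) (p · v · q).
Proof. by case: lt_ordering => _ _ _ h _; apply: h. Qed.

Lemma monomial_ordering_asym u v : lt u v -> ~ lt v u.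
Proof. by move=> uv /(lt_trans uv) /lt_irr. Qed.

(** If n < 1, the powers of n decrease forever. *)
Lemma mone_minimal n : ~ lt n mone.
Proof.
move=> n1; case: lt_ordering => _ _ _ _ /(_ mone).
elim=> m _ IH; apply: (IH (n · m)); have := lt_mul mone m n1.
by rewrite !mul1m.
Qed.

Lemma mulm_injl p m n : p · m = p · n -> m = n.
Proof.
move=> e; apply: contrapT => /lt_total [] /(lt_mul p mone).
  by rewrite !mulm1 e => /lt_irr.
by rewrite !mulm1 e => /lt_irr.
Qed.

Lemma sandwich_inj p q m n : p · m · q = p · n · q -> m = n.
Proof.
move=> e; apply: contrapT => /lt_total [] /(lt_mul p q); rewrite e; exact: lt_irr.
Qed.

Lemma lm_supp f : f <> 0 -> lmw f \in msupp f.
Proof. by move=> f0; case: (lm_spec lt_trans lt_total f0). Qed.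

Lemma lm_max f n : f <> 0 -> n \in msupp f -> n = lmw f \/ lt n (lmw f).
Proof.
move=> f0 nf; case: (lm_spec lt_trans lt_total f0) => _ h.
by case: (eqVneq n (lmw f)) => [|/eqP ne]; [left|right; apply: h].
Qed.

Lemma lc_neq0 f : f <> 0 -> lcw f != 0.
Proof. by move=> f0; rewrite /lc mcoeff_neq0 lm_supp. Qed.

Lemma lmw_unique f w : w \in msupp f ->
  (forall n, n \in msupp f -> n <> w -> lt n w) -> lmw f = w.
Proof. by apply: lm_unique; exact: monomial_ordering_asym. Qed.

Lemma mcoeff_sandwich p q f m : (sandwich p q f)@_(p · m · q) = f@_m.
Proof.
by apply: (@mcoeff_relabel _ _ _ (fun w => p · w · q)) => n _ /sandwich_inj.
Qed.

Lemma lm_sandwich p q f : f <> 0 -> lmw (sandwich p q f) = p · lmw f · q.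
Proof.
move=> f0; apply: lmw_unique.
  by rewrite -mcoeff_neq0 mcoeff_sandwich mcoeff_neq0 lm_supp.
move=> n /msupp_relabel [m /(lm_max f0) [-> //|lt_m] ->] _; exact: lt_mul.
Qed.

(** The two leading terms cancel. *)
Lemma spoly_lt g g' p q p' q' n : g <> 0 -> g' <> 0 ->
  p · lmw g · q = p' · lmw g' · q' ->
  n \in msupp ((lcw g)^-1 *: sandwich p q g - (lcw g')^-1 *: sandwich p' q' g') ->
  lt n (p · lmw g · q).
Proof.
move=> g0 g'0 e; have [->|/eqP ne] := eqVneq n (p · lmw g · q).
  rewrite -mcoeff_neq0 mcoeffB !mcoeffZ mcoeff_sandwich e mcoeff_sandwich.
  by rewrite !mulVf ?lc_neq0 // subrr eqxx.
move/(fsubsetP (msuppB_le _ _)); rewrite in_fsetU.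
case/orP => /(fsubsetP (msuppZ_le _ _))/msupp_relabel [m mg nE].
  have [em|lt_m] := lm_max g0 mg; first by case: ne; rewrite nE em.
  by rewrite nE; exact: lt_mul.
have [em|lt_m] := lm_max g'0 mg; first by case: ne; rewrite nE em.
by rewrite e nE; exact: lt_mul.
Qed.

Lemma sandwich_comp p q u v f :
  sandwich p q (sandwich u v f) = sandwich (p · u) (v · q) f.
Proof.
rewrite /sandwich relabel_comp; apply: eq_relabel => m _ /=.
by rewrite !mulmA.
Qed.

Lemma sandwich_lincomb p q c d u v u' v' g g' :
  sandwich p q (c *: sandwich u v g - d *: sandwich u' v' g') =
  c *: sandwich (p · u) (v · q) g - d *: sandwich (p · u') (v' · q) g'.
Proof.
rewrite sandwichB (sandwichZ c p q (sandwich u v g)).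
rewrite (sandwichZ d p q (sandwich u' v' g')).
by rewrite (sandwich_comp p q u v g) (sandwich_comp p q u' v' g').
Qed.

Lemma tail_lt g n : g <> 0 -> n \in msupp ((lcw g)^-1 *: g - << lmw g >>) ->
  lt n (lmw g).
Proof.
move=> g0; rewrite -mcoeff_neq0 mcoeffB mcoeffZ mcoeffU.
have [<-|/eqP ne] := eqVneq (lmw g) n.
  by rewrite mulVf ?lc_neq0 // subrr eqxx.
rewrite subr0 mulf_eq0 negb_or mcoeff_neq0 => /andP[_ /(lm_max g0)].
by case=> // e; rewrite e in ne.
Qed.

(** [Span G P] is spanned by the products u g v, g in G, whose leading monomial
satisfies P. With [P = (< w)] it plays the role of a standard representation
below w; with P trivial it is the two-sided ideal generated by G. *)
Inductive Span G P : F -> Prop :=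
| Span_zero : Span G P 0
| Span_add c u g v f : G g -> P (u · lmw g · v) -> Span G P f ->
    Span G P (c *: sandwich u v g + f).

Lemma Span_gen G P c u g v : G g -> P (u · lmw g · v) ->
  Span G P (c *: sandwich u v g).
Proof. by move=> Gg Pw; rewrite -[_ *: _]addr0; apply: Span_add => //; left. Qed.

Lemma Span_sub G G' P P' f : (G `<=` G')%classic -> (forall w, P w -> P' w) ->
  Span G P f -> Span G' P' f.
Proof.
move=> GG PP; elim=> [|c u g v {}f /GG Gg /PP Pw _ IH]; first by left.
exact: Span_add.
Qed.

Lemma SpanD G P f h : Span G P f -> Span G P h -> Span G P (f + h).
Proof.
move=> + sh; elim=> [|c u g v {}f Gg Pw _ IH]; first by rewrite add0r.
by rewrite -addrA; apply: Span_add.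
Qed.

Lemma SpanZ G P c f : Span G P f -> Span G P (c *: f).
Proof.
elim=> [|d u g v {}f Gg Pw _ IH]; first by rewrite scaler0; left.
by rewrite scalerDr scalerA; apply: Span_add.
Qed.

Lemma SpanB G P f h : Span G P f -> Span G P h -> Span G P (f - h).
Proof. by move=> sf sh; apply: SpanD => //; rewrite -scaleN1r; apply: SpanZ. Qed.

Lemma Span_sum G P (T : eqType) (s : seq T) (E : T -> F) :
  (forall i, i \in s -> Span G P (E i)) -> Span G P (\sum_(i <- s) E i).
Proof.
move=> h; rewrite big_seq; elim/big_rec: _ => [|i f /h Ei]; first by left.
exact: SpanD.
Qed.

Lemma Span_sandwich G P P' p q f : (forall w, P w -> P' (p · w · q)) ->
  Span G P f -> Span G P' (sandwich p q f).
Proof.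
move=> PP; elim=> [|c u g v {}f Gg Pw _ IH].
  by rewrite /sandwich relabel0; left.
rewrite sandwichD sandwichZ sandwich_comp.
by apply: Span_add => //; have := PP _ Pw; rewrite !mulmA.
Qed.

Lemma Span_supp G w f n : (forall g, G g -> g <> 0) ->
  Span G (lt^~ w) f -> n \in msupp f -> lt n w.
Proof.
move=> G0; elim=> [|c u g v {}f Gg lt_w _ IH]; first by rewrite msupp0 inE.
move/(fsubsetP (msuppD_le _ _)); rewrite inE => /orP[|/IH//].
move/(fsubsetP (msuppZ_le _ _))/msupp_relabel => [m mg ->].
case: (lm_max (G0 _ Gg) mg) => [->//|lt_m].
by apply: lt_trans lt_w; apply: lt_mul.
Qed.

(** The condition [z <> mone] makes the two occurrences overlap, and
[v = mone \/ v' = mone] says that the common multiple has no superfluous right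
factor. Overlaps ([v' = mone]) and inclusions ([v = mone]) are both covered. *)
Definition overlap_resolved G g g' : Prop := forall u z v v',
  lmw g = u · z -> z <> mone -> lmw g' <> mone ->
  lmw g · v = u · lmw g' · v' -> v = mone \/ v' = mone ->
  Span G (lt^~ (lmw g · v))
    ((lcw g)^-1 *: sandwich mone v g - (lcw g')^-1 *: sandwich u v' g').

(** In a product p r m g' x where r lies below a, each monomial of r gives a
multiple of g' whose leading monomial is below p a m lm(g') x. *)
Lemma Span_mull G p r m c g' x a : G g' ->
  (forall n, n \in msupp r -> lt n a) ->
  Span G (lt^~ (p · a · m · lmw g' · x))
    (<< p >> * r * << m >> * (c *: g') * << x >>).
Proof.
move=> Gg ra; rewrite (monalgE r) mul_sum_mid; apply: Span_sum => n nr.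
rewrite mulU_sandwichl sandwichZ scalerA.
apply: Span_gen => //; have := ra _ nr => /(lt_mul p (m · lmw g' · x)).
by rewrite !mulmA.
Qed.

Lemma Span_mulr G p c g m r x a : G g ->
  (forall n, n \in msupp r -> lt n a) ->
  Span G (lt^~ (p · lmw g · m · a · x))
    (<< p >> * (c *: g) * (<< m >> * r * << x >>)).
Proof.
move=> Gg ra; rewrite (monalgE r) mul_sum_right; apply: Span_sum => n nr.
rewrite mulU_sandwichr sandwichZ scalerA.
apply: Span_gen => //; have := ra _ nr => /(lt_mul (p · lmw g · m) x).
by rewrite !mulmA.
Qed.

Section Resolved.
Hypothesis M_equidiv : equidivisible M.
Variable G : set F.
Hypothesis G0 : forall g, G g -> g <> 0.
Hypothesis GR : forall g g', G g -> G g' -> overlap_resolved G g g'.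

Lemma disjoint_resolved p g m g' x : G g -> G g' ->
  Span G (lt^~ (p · lmw g · m · lmw g' · x))
    ((lcw g)^-1 *: sandwich p (m · lmw g' · x) g -
     (lcw g')^-1 *: sandwich (p · lmw g · m) x g').
Proof.
move=> Gg Gg'; rewrite -!sandwichZ !sandwichE.
have -> : << m · lmw g' · x >> = << m >> * << lmw g' >> * << x >> :> F.
  by rewrite mulUUU.
have -> : << p · lmw g · m >> = << p >> * << lmw g >> * << m >> :> F.
  by rewrite mulUUU.
rewrite disjoint_identity; apply: SpanB.
  by apply: Span_mull => // n; apply: tail_lt; apply: G0.
by apply: Span_mulr => // n; apply: tail_lt; apply: G0.
Qed.

(** Any two occurrences of leading monomials in the same monomial are disjoint, or
one of the leading monomials is 1, or they form an overlap or an inclusion up to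
a left and a right factor. *)
Lemma all_resolved p g x p' g' x' : G g -> G g' ->
  p · lmw g · x = p' · lmw g' · x' ->
  Span G (lt^~ (p · lmw g · x))
    ((lcw g)^-1 *: sandwich p x g - (lcw g')^-1 *: sandwich p' x' g').
Proof.
wlog [u ->] : p g x p' g' x' / exists u, p' = p · u.
  move=> H Gg Gg' e; have e1 := e; rewrite -!mulmA in e1.
  case: (M_equidiv e1) => -[u pu _]; first by apply: H => //; exists u.
  by rewrite e -opprB -scaleN1r; apply/SpanZ/H => //; exists u.
move=> Gg Gg' e1; have e : lmw g · x = u · lmw g' · x'.
  by apply: (@mulm_injl p); rewrite !mulmA.
have e2 := e; rewrite -[u · _ · _]mulmA in e2; case: (M_equidiv e2) => -[z].
  move=> um xm; have := disjoint_resolved p z x' Gg Gg'.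
  by rewrite um xm !mulmA.
move=> gz bx; have [z1|/eqP z1] := eqVneq z mone.
  rewrite z1 mulm1 in gz; rewrite z1 mul1m in bx; rewrite -gz -bx.
  by have := disjoint_resolved p mone x' Gg Gg'; rewrite !mulm1 mul1m !mulmA.
(* If lm(g') = 1 then g' is a constant, and its occurrence may be moved to the
   right of lm(g), where it is disjoint from it. *)
have [g1|/eqP g1] := eqVneq (lmw g') mone.
  have supp1 n : n \in msupp g' -> n = mone.
    by move/(lm_max (G0 Gg')); rewrite g1 => -[//|/mone_minimal].
  have -> : sandwich (p · u) x' g' = sandwich (p · lmw g) x g'.
    rewrite /sandwich; apply: eq_relabel => n /supp1 ->; rewrite !mulm1 -!mulmA; congr (_ · _).
    by rewrite e g1 mulm1.
  have := disjoint_resolved p mone x Gg Gg'.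
  by rewrite g1 !mulm1 mul1m.
suff final y v v' : x = v · y -> x' = v' · y ->
    lmw g · v = u · lmw g' · v' -> v = mone \/ v' = mone ->
    Span G (lt^~ (p · lmw g · x))
      ((lcw g)^-1 *: sandwich p x g - (lcw g')^-1 *: sandwich (p · u) x' g').
  case: (M_equidiv e) => -[v ev xv].
    by apply: (final x' v mone); rewrite ?mul1m ?mulm1 //; right.
  by apply: (final x mone v); rewrite ?mul1m ?mulm1 //; left.
move=> -> -> ev v1; have := GR Gg Gg' gz z1 g1 ev v1.
move/(Span_sandwich (P' := lt^~ (p · lmw g · (v · y))) (p := p) (q := y)).
rewrite sandwich_lincomb mulm1; apply=> w wl.
by have := lt_mul p y wl; rewrite !mulmA.
Qed.

Lemma Span_bounded P f : Span G P f -> f = 0 \/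
  exists w, P w /\ Span G (fun n => n = w \/ lt n w) f.
Proof.
elim=> [|c u g v {}f Gg Pn _ IH]; first by left.
right; set n := u · lmw g · v in Pn *.
have lift w w' h : (w = w' \/ lt w w') -> Span G (fun n => n = w \/ lt n w) h ->
    Span G (fun n => n = w' \/ lt n w') h.
  move=> ww; apply: Span_sub => // m [->//|mw]; right.
  by case: ww => [<-//|]; apply: lt_trans.
case: IH => [->|[w [Pw sf]]].
  by exists n; split=> //; rewrite addr0; apply: Span_gen => //; left.
have [e|/eqP ne] := eqVneq n w.
  by exists w; split=> //; apply: Span_add => //; left.
case: (lt_total ne) => nw.
  by exists w; split=> //; apply: Span_add => //; right.
exists n; split=> //; apply: Span_add => //; first by left.
by apply: lift sf; right.
Qed.

(** All products with leading monomial w agree modulo smaller ones, so one of them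
is enough. *)
Lemma Span_top w f : Span G (fun n => n = w \/ lt n w) f -> Span G (lt^~ w) f \/
  exists c p g x f', [/\ G g, w = p · lmw g · x, Span G (lt^~ w) f' &
    f = c *: sandwich p x g + f'].
Proof.
elim=> [|c u g v {}f Gg un _ IH]; first by left; left.
case: un => [un|un]; last first.
  case: IH => [IH|[d [p [g' [x [f' [Gg' w' sf' ->]]]]]]].
    by left; apply: Span_add.
  right; exists d, p, g', x, (c *: sandwich u v g + f').
  by split; [exact: Gg' | exact: w' | exact: Span_add | exact: addrCA].
right; case: IH => [IH|[d [p [g' [x [f' [Gg' w' sf' ->]]]]]]].
  by exists c, u, g, v, f; rewrite un.
exists (c + d * lcw g' / lcw g), u, g, v.
pose D := (lcw g)^-1 *: sandwich u v g - (lcw g')^-1 *: sandwich p x g'.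
exists (f' - (d * lcw g') *: D); split; rewrite ?un //.
  apply: SpanB => //; apply: SpanZ; rewrite /D -un.
  by apply: all_resolved => //; rewrite un.
by apply: combine_top; apply: lc_neq0; apply: G0.
Qed.

(** Well-founded induction on a bound w of the leading monomials involved: the
term at w either survives and is the leading term, or it has coefficient 0 and
the bound can be lowered. *)
Theorem diamond P f : Span G P f -> f <> 0 ->
  exists2 g, G g & exists u v, lmw f = u · lmw g · v.
Proof.
move=> sf f0; case: (Span_bounded sf) => [//|[w [_ {}sf]]].
case: lt_ordering => _ _ _ _ /(_ w) wacc; elim: w / wacc sf => w _ IH sf.
have rec : Span G (lt^~ w) f ->
    exists2 g, G g & exists u v, lmw f = u · lmw g · v.
  by case/Span_bounded => [//|[w' [w'w]]]; apply: IH.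
case: (Span_top sf) => [//|[c [p [g [x [f' [Gg wE sf' fE]]]]]]].
have [c0|c0] := eqVneq c 0; first by apply: rec; rewrite fE c0 scale0r add0r.
have ltf' n : n \in msupp f' -> lt n w by exact: (Span_supp G0 sf').
have wf' : w \notin msupp f' by apply/negP => /ltf' /lt_irr.
exists g => //; exists p, x; rewrite -wE; apply: lmw_unique.
  rewrite -mcoeff_neq0 fE mcoeffD (mcoeff_outdom wf') addr0 mcoeffZ wE.
  by rewrite mcoeff_sandwich mulf_neq0 ?lc_neq0 //; apply: G0.
move=> n; rewrite fE => /(fsubsetP (msuppD_le _ _)); rewrite inE => /orP[|/ltf'//].
move/(fsubsetP (msuppZ_le _ _))/msupp_relabel => [m mg ->].
rewrite wE; case: (lm_max (G0 Gg) mg) => [->//|lt_m _]; exact: lt_mul.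
Qed.

End Resolved.
End Diamond.

(** * Words as place monomials *)

Section PlaceMonomials.
Local Open Scope ring_scope.
Variables (K : fieldType) (N : option nat).
Local Notation A := (xtvar N).
Local Notation W := {fmonom A}.
Local Notation PM := {cmonom (A * nat)%type}.
Local Notation Fbar := 'Fbar[K, N].
Local Notation Pbar := 'Pbar[K, N].
Implicit Types (w u v : seq A) (k j : nat).

(** Place k+j carries the j-th letter of w: [pword 0] is the letterplace embedding
on words, and [pword k] its shift. *)
Definition pword k w : PM :=
  \big[mmul/mone]_(p <- zip w (seq.iota k (size w))) ucm p.

(** The image of a letterplace word under psi, with empty places where t was. *)
Definition t_free_part w : PM :=
  \big[mmul/mone]_(p <- zip w (seq.iota 0 (size w)) | isSome p.1) ucm p.

Lemma bigmmulE (T : choiceType) (I : Type) (s : seq I) (P : pred I)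
    (E : I -> {cmonom T}) q :
  (\big[mmul/mone]_(i <- s | P i) E i) q = (\sum_(i <- s | P i) E i q)%N.
Proof.
apply: (big_morph (fun m : {cmonom T} => m q)) => [m n|]; last exact: cm1.
exact: cmM.
Qed.

Lemma pword_cons k x w : pword k (x :: w) = mmul (ucm (x, k)) (pword k.+1 w).
Proof. by rewrite /pword big_cons. Qed.

Lemma pwordE k w (y : A) j :
  pword k w (y, j) = [&& k <= j, j < k + size w & nth None w (j - k) == y]%N :> nat.
Proof.
elim: w k => [|x w IH] k.
  by rewrite /pword /= big_nil cm1 addn0; case: leqP => //= h; rewrite ltnNge h.
rewrite pword_cons cmM cmU IH xpair_eqE /= addnS.
case: (ltngtP k j) => kj /=.
- by have -> : (j - k = (j - k.+1).+1)%N; [lia | rewrite andbF add0n ?addSn].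
- by rewrite andbF.
- by rewrite kj subnn andbT addn0 ltnS leq_addr.
Qed.

Lemma t_free_partE w (y : A) j :
  t_free_part w (y, j) = if isSome y then pword 0 w (y, j) else 0%N.
Proof.
rewrite /t_free_part /pword !bigmmulE; case: y => [y|] /=.
  by rewrite big_mkcond; apply: eq_bigr => -[[z|] i] _ //=; rewrite cmU.
by rewrite big1 // => -[[z|] i] //= _; rewrite cmU.
Qed.

Lemma pword_cat k u v : pword k (u ++ v) = mmul (pword k u) (pword (k + size u) v).
Proof.
by rewrite /pword size_cat iotaD zip_cat ?size_iota // big_cat.
Qed.

Lemma pword_inj k w w' : pword k w = pword k w' -> w = w'.
Proof.
move=> e; have e' y j : pword k w (y, j) = pword k w' (y, j) by rewrite e.
have inw u j : (j < size u)%N -> pword k u (nth None u j, k + j)%N = 1%N.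
  by move=> ju; rewrite pwordE leq_addr ltn_add2l ju addKn eqxx.
have le u u' : (forall y j, pword k u (y, j) = pword k u' (y, j)) -> (size u <= size u')%N.
  move=> h; case: leqP => // lt; have := inw _ _ lt; rewrite h pwordE.
  by rewrite ltnn andbF.
have ss : size w = size w' by apply/eqP; rewrite eqn_leq !le.
apply: (@eq_from_nth _ None) => // j jw; have := inw _ _ jw; rewrite e' pwordE.
by rewrite leq_addr ltn_add2l -ss jw addKn; case: eqP.
Qed.

Lemma letterplaceE (f : Fbar) : letterplace f = relabel (fun w : W => pword 0 w) f.
Proof. by rewrite relabel.unlock. Qed.

(** Substitution is multiplicative, so it may be computed letter by letter. *)
Lemma subst_pword (R : comNzRingType) (h : A * nat -> R) k w :
  \prod_(p <- finsupp (pword k w)) h p ^+ (pword k w) p =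
  \prod_(p <- zip w (seq.iota k (size w))) h p.
Proof.
pose E (m : PM) : R := \prod_(p <- finsupp m) h p ^+ m p.
have Ew (d : {fset A * nat}) (m : PM) : (finsupp m `<=` d)%fset ->
    E m = \prod_(p <- d) h p ^+ m p.
  move=> le; rewrite /E (big_fset_incl _ le) // => p _ pm.
  by rewrite fsfun_dflt.
rewrite -/(E (pword k w)) /pword; apply: (big_ind2 (fun m x => E m = x)).
- by rewrite /E mdom1 big_seq_fset0.
- move=> m x n y <- <-.
  rewrite (@Ew (finsupp m `|` finsupp n)%fset) ?mdomD //.
  rewrite (@Ew (finsupp m `|` finsupp n)%fset m) ?fsubsetUl //.
  rewrite (@Ew (finsupp m `|` finsupp n)%fset n) ?fsubsetUr //.
  by rewrite -big_split; apply: eq_bigr => p _; rewrite cmM exprD.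
- by move=> p _; rewrite /E mdomU big_seq_fset1 cmUU expr1.
Qed.

Lemma prodU (I : Type) (s : seq I) (P : pred I) (E : I -> PM) :
  \prod_(i <- s | P i) << E i >> =
  << \big[mmul/mone]_(i <- s | P i) E i >> :> Pbar.
Proof.
apply/esym/(big_morph (fun m : PM => << m >> : Pbar)) => // m n.
by rewrite mulUU mulr1.
Qed.

Lemma Pbar_endo_relabel h (s t : W -> PM) (f : Fbar) :
  (forall w : W, w \in msupp f ->
     \prod_(p <- finsupp (s w)) h p ^+ (s w) p = << t w >>) ->
  Pbar_endo h (relabel s f) = relabel t f.
Proof.
move=> e; have -> : relabel s f = \sum_(w <- msupp f) << f@_w *g s w >>.
  by rewrite relabel.unlock.
rewrite relabel.unlock /Pbar_endo raddf_sum; apply: eq_big_seq => w wf.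
by rewrite /= mmapU e // mulUU mul1m mulr1.
Qed.

Lemma shift_lp k (f : Fbar) :
  shift k (letterplace f) = relabel (fun w : W => pword k w) f.
Proof.
rewrite letterplaceE; apply: Pbar_endo_relabel => w _; rewrite subst_pword.
have zip_mapr s : zip w (map (addn k) s) =
    map (fun p => (p.1, (k + p.2)%N)) (zip w s).
  by elim: (w : seq _) s => [|x u IH] [|n s] //=; rewrite IH.
by rewrite prodU /pword -{2}[k]addn0 iotaDl zip_mapr big_map.
Qed.

Lemma psi_lp (f : Fbar) : psi (letterplace f) = relabel (fun w : W => t_free_part w) f.
Proof.
rewrite letterplaceE; apply: Pbar_endo_relabel => w _; rewrite subst_pword.
rewrite /t_free_part -prodU [RHS]big_mkcond; apply: eq_bigr => -[[y|] j] _ //.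
Qed.
End PlaceMonomials.

Lemma lcmcmE (V : choiceType) (m n : {cmonom V}) v :
  lcmcm m n v = maxn (m v) (n v).
Proof.
rewrite /lcmcm cmE fsfunE inE; case: ifP => // /negbT.
by rewrite negb_or -!cmE_eq0 => /andP[/eqP-> /eqP->].
Qed.

Lemma gcdcmE (V : choiceType) (m n : {cmonom V}) v :
  gcdcm m n v = minn (m v) (n v).
Proof.
rewrite /gcdcm cmE fsfunE inE; case: ifP => // /negbT.
by rewrite negb_or -!cmE_eq0 => /andP[/eqP-> /eqP->].
Qed.

Lemma cm_ext (V : choiceType) (m n : {cmonom V}) : (forall v, m v = n v) -> m = n.
Proof. by move=> e; apply/eqP/cmP. Qed.

Lemma place_partE N (m : {cmonom (xtvar N * nat)%type}) j y :
  place_part m j y = m (y, j).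
Proof.
rewrite /place_part cmE fsfunE; case: ifP => // /negbT ny.
apply/esym/eqP; rewrite cmE_eq0; apply: contra ny => ym.
by apply/imfsetP; exists (y, j).
Qed.

(** * The place ordering on words *)

Section Words.
Variables (N : option nat).
Local Notation A := (xtvar N).
Local Notation W := {fmonom A}.

Definition letter_rank (y : A) : nat := if y is Some i then (val i).+1 else 0%N.

Lemma letter_rank_inj : injective letter_rank.
Proof. by move=> [i|] [j|] //= [] /val_inj ->. Qed.

Definition word_lt : W -> W -> Prop := deg_rlex letter_rank.

Lemma word_lt_ordering : monomial_ordering word_lt.
Proof.
split.
- exact: deg_rlex_irr.
- exact: deg_rlex_trans.
- exact: (deg_rlex_total letter_rank_inj).
- by move=> m n p q; apply: deg_rlex_mul.
- exact: deg_rlex_wf.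
Qed.

Lemma cat_eq_split (T : Type) (p s p' s' : seq T) : p ++ s = p' ++ s' ->
  (exists2 u, p' = p ++ u & s = u ++ s') \/ (exists2 u, p = p' ++ u & s' = u ++ s).
Proof.
elim: p p' => [|x p IH] [|x' p'] //=.
- by move=> ->; left; exists [::].
- by move=> ->; left; exists (x' :: p').
- by move=> <-; right; exists (x :: p).
- by move=> [<- /IH[] [u -> ->]]; [left | right]; exists u.
Qed.

Lemma word_equidivisible : equidivisible W.
Proof.
move=> p s p' s' /(congr1 (@fmonom_val A)); rewrite !fmM.
by case/cat_eq_split => -[u pu su]; [left | right]; exists (FMonom u);
  apply/eqP; rewrite fmP fmM; apply/eqP.
Qed.

Section Place.
Variable lt : {cmonom A} -> {cmonom A} -> Prop.
Hypothesis lt_ordering : monomial_ordering lt.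
Hypothesis lt_variables : ordered_variables lt.

Lemma place_lt_asym m n : place_lt lt m n -> ~ place_lt lt n m.
Proof.
case: lt_ordering => irr tr _ _ _.
move=> [i [ie il]] [j [je jl]]; case: (ltngtP i j) => ij.
- by move: jl; rewrite ie // => /irr.
- by move: il; rewrite je // => /irr.
- by subst j; exact: irr (tr _ _ _ il jl).
Qed.

Lemma place_part_pword k (w : seq A) j : (j < size w)%N ->
  place_part (pword k w) (k + j) = ucm (nth None w j).
Proof.
move=> jw; apply: cm_ext => y; rewrite place_partE pwordE cmU.
by rewrite leq_addr ltn_add2l jw addKn.
Qed.

(** At the last place where two words of the same length differ, the place
ordering compares two variables, as the word ordering does. *)
Lemma place_lt_pword k (u v : W) : size u = size v -> word_lt u v ->
  place_lt lt (pword k u) (pword k v).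
Proof.
move=> uv [|[_ [j [je jl]]]]; first by rewrite uv ltnn.
have ju : (j < size u)%N.
  rewrite ltnNge; apply/negP => h.
  by move: jl; rewrite !nth_default ?size_map -?uv.
have jv : (j < size v)%N by rewrite -uv.
exists (k + j)%N; split=> [i ki|].
  apply: cm_ext => y; rewrite !place_partE !pwordE -uv.
  case: (leqP k i) => //= ki'; case: (ltnP i (k + size u)) => //= iu.
  have iju : (i - k < size u)%N by rewrite ltn_subLR.
  have jik : (j < i - k)%N by lia.
  have := je _ jik; rewrite !(nth_map None) -?uv // => /letter_rank_inj ->.
  by [].
rewrite !place_part_pword //; move: jl; rewrite !(nth_map None) //.
case: lt_variables => v1 v2.
case: (nth None u j) => [a|]; case: (nth None v j) => [b|] //= ab.
exact: v2.
Qed.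

End Place.
End Words.

Section LeadingPlace.
Local Open Scope ring_scope.
Variables (K : fieldType) (N : option nat).
Local Notation A := (xtvar N).
Local Notation W := {fmonom A}.
Local Notation PM := {cmonom (A * nat)%type}.
Local Notation Fbar := 'Fbar[K, N].
Local Notation Pbar := 'Pbar[K, N].
Variable lt : {cmonom A} -> {cmonom A} -> Prop.
Hypothesis lt_ordering : monomial_ordering lt.
Hypothesis lt_variables : ordered_variables lt.
Implicit Types f g : Fbar.

Definition homogeneous d f : Prop := forall w : W, w \in msupp f -> size w = d.

Definition letterplace_at k f : Pbar := relabel (fun w : W => pword k w) f.

Local Notation lmw := (lm (@word_lt N)).
Local Notation lcw := (lc (@word_lt N)).
Local Notation lmP := (lm (place_lt lt)).
Local Notation lcP := (lc (place_lt lt)).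

Lemma pwordW_inj k (w w' : W) : pword k w = pword k w' -> w = w'.
Proof. by move/pword_inj => e; apply/eqP; rewrite fmP e. Qed.

Lemma mcoeff_lp k f (w : W) : (letterplace_at k f)@_(pword k w) = f@_w.
Proof.
by apply: (@mcoeff_relabel K W PM (fun w : W => pword k w)) => n _ /pwordW_inj.
Qed.

Lemma msupp_lp k f m : m \in msupp (letterplace_at k f) ->
  exists2 w : W, w \in msupp f & m = pword k w.
Proof. exact: msupp_relabel. Qed.

Lemma lp_eq0 k f : letterplace_at k f = 0 -> f = 0.
Proof. by move=> e; apply/malgP => w; rewrite -(mcoeff_lp k) e !mcoeff0. Qed.

Lemma lp_inj k f g : letterplace_at k f = letterplace_at k g -> f = g.
Proof. by move=> e; apply/malgP => w; rewrite -!(mcoeff_lp k) e. Qed.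

Lemma lm_lp k d f : f <> 0 -> homogeneous d f ->
  lmP (letterplace_at k f) = pword k (lmw f).
Proof.
move=> f0 hf; have lf := lm_supp (@word_lt_ordering N) f0.
apply: lm_unique; first exact: place_lt_asym.
  by rewrite -mcoeff_neq0 mcoeff_lp mcoeff_neq0.
move=> m /msupp_lp [w wf ->] ne; apply: place_lt_pword => //.
  by rewrite !hf.
by case: (lm_max (@word_lt_ordering N) f0 wf) => // e; case: ne; rewrite e.
Qed.

Lemma lc_lp k d f : f <> 0 -> homogeneous d f -> lcP (letterplace_at k f) = lcw f.
Proof. by move=> f0 hf; rewrite /lc (lm_lp k f0 hf) mcoeff_lp. Qed.

End LeadingPlace.

(** * Reduction in the free algebra *)

Section PlaceDivision.
Variable N : option nat.
Local Notation A := (xtvar N).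
Local Notation W := {fmonom A}.
Local Notation "u · v" := (mmul u v) (at level 40, left associativity).

Lemma pword_nil k : pword k [::] = mone :> {cmonom (A * nat)%type}.
Proof. by rewrite /pword big_nil. Qed.

Lemma pword_sandwich (u n v : W) : pword 0 (u · n · v) =
  mmul (mmul (pword 0 u) (pword (size u) n)) (pword (size u + size n) v).
Proof. by rewrite !fmM !pword_cat size_cat add0n. Qed.

Lemma pword_div (u v z n : W) : size n = size v ->
  mmul (divcm (pword 0 (u · v · z)) (pword (size u) v)) (pword (size u) n) =
  pword 0 (u · n · z).
Proof.
move=> nv; rewrite !pword_sandwich nv; apply: cm_ext => q.
by rewrite !cmM divcmE !cmM; lia.
Qed.

(** The quotient of a letterplace word w by a shifted word v is multilinear with
its places on the two sides of v, so it acts on words of the length of v as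
[n |-> u n z]. An empty v divides at every shift, even one beyond the end of w:
then u is empty and z = w. *)
Lemma pword_dvd k (v w : W) : dvdcm (pword k v) (pword 0 w) ->
  exists u z : W, [/\ w = u · v · z, (v <> mone -> size u = k) &
  forall n : W, size n = size v ->
    mmul (divcm (pword 0 w) (pword k v)) (pword k n) = pword 0 (u · n · z)].
Proof.
move=> [q e]; have [v1|/eqP v1] := eqVneq v mone.
  exists mone, w; split; rewrite ?v1 ?mul1m //.
  move=> n; rewrite fm1 => /size0nil n1.
  have -> : n = mone by apply/eqP; rewrite fmP n1 fm1.
  rewrite fm1 pword_nil mulm1 !mul1m; apply: cm_ext => p.
  by rewrite divcmE cm1 subn0.
have v0 : (0 < size v)%N.
  rewrite lt0n; apply/eqP => /size0nil v0; apply: v1.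
  by apply/eqP; rewrite fmP v0 fm1.
have nthw j : (j < size v)%N ->
    (k + j < size w)%N /\ nth None w (k + j) = nth None v j.
  move=> jv; have : (0 < pword 0 w (nth None v j, k + j)%N)%N.
    by rewrite e cmM pwordE leq_addr ltn_add2l jv addKn eqxx.
  by rewrite pwordE add0n subn0 lt0b => /and3P[_ -> /eqP].

have kw : (k + size v <= size w)%N.
  by have [] := nthw (size v).-1; rewrite ?prednK // -addnS prednK.
have wE : w = FMonom (take k w) · v · FMonom (drop (k + size v) w).
  apply/eqP; rewrite fmP !fmM /= -catA; apply/eqP.
  rewrite -{1}(cat_take_drop k w); congr (_ ++ _).
  rewrite -{1}(cat_take_drop (size v) (drop k w)) drop_drop addnC.
  congr (_ ++ _); have sz : size (take (size v) (drop k w)) = size v.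
    by rewrite size_takel // size_drop leq_subRL ?(leq_trans _ kw) // leq_addr.
  apply: (@eq_from_nth _ None) => // j; rewrite sz => jv.
  by rewrite nth_take // nth_drop; case: (nthw _ jv).
have sk : size (FMonom (take k w)) = k.
  by rewrite /= size_takel // (leq_trans _ kw) // leq_addr.
exists (FMonom (take k w)), (FMonom (drop (k + size v) w)); split=> // n nv.
by have := pword_div (FMonom (take k w)) (FMonom (drop (k + size v) w)) nv; rewrite sk -wE.
Qed.
End PlaceDivision.

Section Reduction.
Local Open Scope ring_scope.
Variables (K : fieldType) (N : option nat).
Local Notation A := (xtvar N).
Local Notation W := {fmonom A}.
Local Notation PM := {cmonom (A * nat)%type}.
Local Notation Fbar := 'Fbar[K, N].
Local Notation Pbar := 'Pbar[K, N].
Variable lt : {cmonom A} -> {cmonom A} -> Prop.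
Hypothesis lt_ordering : monomial_ordering lt.
Hypothesis lt_variables : ordered_variables lt.
Implicit Types f g : Fbar.
Local Notation lmw := (lm (@word_lt N)).
Local Notation "u · v" := (mmul u v) (at level 40, left associativity).

Lemma letterplace_lp f : letterplace f = letterplace_at 0 f.
Proof. exact: letterplaceE. Qed.

Lemma shift_letterplace k f : shift k (letterplace f) = letterplace_at k f.
Proof. exact: shift_lp. Qed.

Lemma mul_lp (c : K) (m : PM) k (u z : W) f :
  (forall n, n \in msupp f -> mmul m (pword k n) = pword 0 (u · n · z)) ->
  << c *g m >> * letterplace_at k f = letterplace_at 0 (c *: sandwich u z f).
Proof.
move=> h; rewrite mulU_relabel /letterplace_at relabelZ; congr (_ *: _).
rewrite /sandwich relabel_comp relabel_comp; exact: eq_relabel.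
Qed.

Definition homogeneous_basis (G : set Fbar) : Prop :=
  forall f, G f -> f <> 0 /\ exists d, homogeneous d f.

Lemma sandwich_supp (u v n : W) f : n \in msupp (sandwich u v f) ->
  exists2 m, m \in msupp f & n = u · m · v.
Proof. exact: msupp_relabel. Qed.

Variable G : set Fbar.
Hypothesis G_proper : homogeneous_basis G.

(** A reduction step replaces eta by [eta - c u g z], where the word u lm(g) z is
the leading word of eta, hence smaller than w0. *)
Lemma Reduce_lp d (w0 : W) (h r : Pbar) :
  Reduce (place_lt lt) (shift_set [set letterplace f | f in G]%classic) h r ->
  forall eta : Fbar, h = letterplace_at 0 eta -> homogeneous d eta ->
  (forall n, n \in msupp eta -> word_lt n w0) ->
  exists rho : Fbar, [/\ r = letterplace_at 0 rho, homogeneous d rho,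
    (forall n, n \in msupp rho -> word_lt n w0),
    Span (@word_lt N) G (fun n => word_lt n w0) (eta - rho) &
    rho <> 0 -> forall k g, G g -> ~ dvdcm (pword k (lmw g)) (pword 0 (lmw rho))].
Proof.
elim=> {h r} [h hstop eta he hom small|
    h g r h0 _ [k [_ [g0 Gg0 <-] ->]] gn0 dv _ IH eta he hom small].
  exists eta; split=> //; first by rewrite subrr; left.
  move=> eta0 k g Gg [q e]; apply: hstop.
  have hn : h <> 0 by rewrite he => /lp_eq0.
  split=> //; rewrite he (lm_lp lt_ordering lt_variables 0 eta0 hom).
  have [gn [d' gh]] := G_proper Gg.
  move=> J [_ _ Jmul] sub; have := Jmul 1 (<< pword k (lmw g) >>) << q >>.
  rewrite mul1r mulUU mulr1 -e; apply; apply: sub.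
  exists (letterplace_at k g); last by rewrite (lm_lp lt_ordering lt_variables k gn gh).
  split; last by move/lp_eq0.
  by exists k; exists (letterplace g); [exists g | rewrite shift_letterplace].
rewrite shift_letterplace in gn0 dv IH.
have [g0n [d' g0h]] := G_proper Gg0.
have eta0 : eta <> 0 by move=> e; apply: h0; rewrite he e /letterplace_at relabel0.
rewrite he (lm_lp lt_ordering lt_variables 0 eta0 hom) in dv IH.
rewrite (lm_lp lt_ordering lt_variables k g0n g0h) in dv IH.
have [u [z [wE _ divE]]] := pword_dvd dv.
have g0sz (n : W) : n \in msupp g0 -> size n = size (lmw g0).
  by move=> ng; rewrite (g0h _ ng) (g0h _ (lm_supp (@word_lt_ordering N) g0n)).
set c := _ / _ in IH.
rewrite (@mul_lp c _ k u z) in IH; last by move=> n /g0sz; apply: divE.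
pose s := c *: sandwich u z g0; rewrite -/s in IH.
have etaS : lmw eta \in msupp eta := lm_supp (@word_lt_ordering N) eta0.
have sS (n : W) : n \in msupp s -> size n = d /\ word_lt n w0.
  move/(fsubsetP (msuppZ_le _ _))/sandwich_supp => [m mg ->]; split.
    by rewrite -(hom _ etaS) wE !fmM !size_cat (g0sz _ mg).
  have lw := small _ etaS; rewrite wE in lw.
  case: (lm_max (@word_lt_ordering N) g0n mg) => [-> //|ml].
  exact: deg_rlex_trans (deg_rlex_mul _ _ ml) lw.
have supp' (n : W) : n \in msupp (eta - s) -> n \in msupp eta \/ n \in msupp s.
  by move/(fsubsetP (msuppB_le _ _)); rewrite inE => /orP.
case: (IH (eta - s)).
- by rewrite /letterplace_at relabelB.
- by move=> n /supp' [/hom|/sS[]].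
- by move=> n /supp' [/small|/sS[]].
move=> rho [-> rhom rsmall sp irr]; exists rho; split=> //.
rewrite (_ : eta - rho = s + (eta - s - rho)); last first.
  by rewrite addrA [s + _]addrC subrK.
by apply: Span_add => //; rewrite -wE; exact: small.
Qed.
End Reduction.

(** * Dividing a remainder by a power of t *)

Section NormalWords.
Variable N : option nat.
Local Notation A := (xtvar N).
Local Notation W := {fmonom A}.

Lemma normal_word (w : seq A) :
  (forall u i z, w <> u ++ [:: None, Some i & z]) ->
  exists (s : seq (xvar N)) k, w = map Some s ++ nseq k None.
Proof.
elim: w => [|x w IH] h; first by exists [::], 0%N.
have [|s [k wE]] := IH; first by move=> u i z e; apply: (h (x :: u) i z); rewrite e.
case: x h => [i|] h; first by exists (i :: s), k; rewrite wE.
case: s wE => [|i s] wE; first by exists [::], k.+1; rewrite wE.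
by case: (h [::] i (map Some s ++ nseq k None)); rewrite wE.
Qed.

(** Scanning from the right, a smaller word of the same length can only have a
smaller letter at the first difference, and nothing is smaller than t. *)
Lemma normal_word_lower (n w : W) (w1 : seq A) k : size n = size w ->
  w = w1 ++ nseq k None :> seq A -> n = w \/ word_lt n w ->
  n = take (size w1) n ++ nseq k None :> seq A.
Proof.
move=> nw wE nlew; rewrite -{1}(cat_take_drop (size w1) n); congr (_ ++ _).
case: nlew => [->|/(deg_rlexP (@letter_rank_inj N) nw)]; first by rewrite wE drop_size_cat.
move=> [a [b [c [x [y [nE wE' ab xy]]]]]].
have bw : (size b < size w1)%N.
  rewrite ltnNge; apply/negP => le; have : nth None w (size b) = y.
    by rewrite wE' nth_cat ltnn subnn.
  by rewrite wE nth_cat ltnNge le /= nth_nseq if_same => yE; rewrite -yE in xy.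
have -> : nseq k None = drop (size w1) w by rewrite wE drop_size_cat.
rewrite nE wE' !drop_cat ab ltnNge (ltnW bw) /=.
by rewrite -[(size w1 - size b)%N]prednK ?subn_gt0.
Qed.

Lemma t_free_part_pad (n : seq A) k : t_free_part (n ++ nseq k None) = t_free_part n.
Proof.
apply: cm_ext => -[[y|] j]; rewrite !t_free_partE //= pword_cat cmM [X in (_ + X)%N]pwordE.
rewrite nth_nseq if_same; case: eqP => //.
by rewrite !andbF addn0.
Qed.

Lemma multideg_t_free_part (n : seq A) j :
  multideg (t_free_part n) j = (j < size n) && isSome (nth None n j) :> nat.
Proof.
rewrite /multideg; case: ltnP => jn /=; last first.
  have -> : place_part (t_free_part n) j = mone.
    apply: cm_ext => y; rewrite place_partE t_free_partE cm1 pwordE add0n ltnNge jn.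
    by rewrite if_same.
  exact: mdeg1.
case ny: (nth None n j) => [y|] /=.
  have -> : place_part (t_free_part n) j = ucm (Some y).
    apply: cm_ext => z; rewrite place_partE t_free_partE cmU pwordE add0n jn subn0 ny.
    by case: z.
  exact: mdegU.
have -> : place_part (t_free_part n) j = mone.
  apply: cm_ext => z; rewrite place_partE t_free_partE cm1 pwordE add0n jn subn0 ny.
  by case: z.
exact: mdeg1.
Qed.

(** A word without t fills all its places, so its letters can be read off; a word
with t leaves places empty. *)
Lemma t_free_part_eq (n w : seq A) : size n = size w -> all isSome w ->
  t_free_part n = t_free_part w -> n = w.
Proof.
move=> nw wX e; apply: (@eq_from_nth _ None) => // j jn.
have jw : (j < size w)%N by rewrite -nw.
have := all_nthP None wX _ jw; case wy: (nth None w j) => [y|] // _.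
have : t_free_part n (Some y, j) = 1%N.
  by rewrite e t_free_partE /= pwordE add0n jw subn0 wy eqxx.
by rewrite t_free_partE /= pwordE add0n jn subn0 /=; case: eqP.
Qed.
End NormalWords.

Section Rehomogenization.
Local Open Scope ring_scope.
Variables (K : fieldType) (N : option nat).
Local Notation A := (xtvar N).
Local Notation W := {fmonom A}.
Local Notation PM := {cmonom (A * nat)%type}.
Local Notation Fbar := 'Fbar[K, N].

(** The word w, which has no t, makes every maximal multidegree equal to 1 at the
places below d, and so t is put back exactly at the empty places. *)
Lemma multihomog_t_free_part d (f : Fbar) (w : W) : homogeneous d f ->
  w \in msupp f -> all isSome w ->
  multihomog (relabel (fun w : W => t_free_part w) f) = letterplace f.
Proof.
move=> hom wf wX; set h := relabel _ f.
have suppP m : m \in msupp h -> exists2 n : W, n \in msupp f & m = t_free_part n.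
  exact: msupp_relabel.
have wh : t_free_part w \in msupp h.
  rewrite -mcoeff_neq0 (@mcoeff_relabel _ _ _ (fun w : W => t_free_part w)).
    by rewrite mcoeff_neq0.
  move=> n nf /t_free_part_eq e; apply/eqP; rewrite fmP e //.
  by rewrite (hom _ nf) (hom _ wf).
have mh m j : m \in msupp h -> (multideg m j <= (j < d))%N.
  move/suppP => [n nf ->]; rewrite multideg_t_free_part (hom _ nf).
  by case: ltnP => //= _; exact: leq_b1.
have maxh j : max_multideg h j = (j < d)%N :> nat.
  apply/eqP; rewrite eqn_leq; apply/andP; split.
    by apply/bigmax_leqP_seq => m mf _; exact: mh.
  apply: (@leq_trans (multideg (t_free_part w) j)); last exact: leq_bigmax_seq.
  rewrite multideg_t_free_part (hom _ wf); case: ltnP => //= jd.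
  by rewrite lt0b; apply: (all_nthP None wX); rewrite (hom _ wf).
have placesE j : (j \in places h) = (j < d)%N.
  apply/imfset2P/idP => [[m /= mh' [[y i] /= ym ->]]|jd] /=.
    move/suppP: mh' ym => [n nf ->]; rewrite -cmE_neq0 t_free_partE.
    case: y => // y; rewrite pwordE add0n (hom _ nf).
    by case: ltnP => //; rewrite /= eqxx.
  exists (t_free_part w) => //=; exists (nth None w j, j) => //.
  rewrite -cmE_neq0 t_free_partE pwordE add0n (hom _ wf) jd subn0 eqxx.
  have := all_nthP None wX j; rewrite (hom _ wf) => /(_ jd).
  by case: (nth None w j).
(* At a place below d the exponent of t is 0 or 1; T collects the places of
   exponent 1. *)
pose T (m : PM) : PM := \big[mmul/mone]_(k <- places h |
  (max_multideg h k - multideg m k == 1)%N) ucm (None, k).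
have -> : multihomog h = relabel (fun m => mmul m (T m)) h.
  rewrite /multihomog relabel.unlock; apply: eq_big_seq => m mf.
  rewrite [X in _ * X](_ : _ = << T m >>) ?mulUU ?mulr1 // -prodU [RHS]big_mkcond.
  apply: eq_bigr => k _; case: ifP => [/eqP->|ne]; first by rewrite expr1.
  rewrite (_ : (_ - _)%N = 0%N) ?expr0 //; move: ne; rewrite maxh.
  by have := mh _ k mf; case: (k < d)%N; case: (multideg m k) => [|[]].
rewrite relabel_comp letterplaceE; apply: eq_relabel => n nf /=.
apply: cm_ext => -[y j]; rewrite cmM t_free_partE /T [X in (_ + X)%N]bigmmulE.
have -> : (\sum_(i <- places h | max_multideg h i - multideg (t_free_part n) i == 1)
    ucm (None, i) (y, j) = [&& y == None, j < d & nth None n j == None])%N.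
  transitivity (\sum_(i <- places h | i == j)
      ((max_multideg h i - multideg (t_free_part n) i == 1) && (y == None)))%N.
    rewrite [LHS]big_mkcond [RHS]big_mkcond; apply: eq_bigr => i _.
    rewrite cmU xpair_eqE [None == y]eq_sym.
    by case: (_ == 1)%N; case: (i == j); rewrite ?andbF ?andbT.
  case: (boolP (j \in places h)) => [jh|njh].
    rewrite -big_filter filter_pred1_uniq ?fset_uniq // big_seq1 maxh multideg_t_free_part (hom _ nf).
    move: jh; rewrite placesE => -> /=; rewrite andbC.
    by case: (nth None n j).
  rewrite big_seq_cond big1 => [|i /andP[ih /eqP e]].
    by move: njh; rewrite placesE => /negPf->; rewrite andbF.
  by rewrite -e ih in njh.
case: y => [y|] /=; first by rewrite addn0.
by rewrite pwordE !add0n (hom _ nf) subn0.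
Qed.
End Rehomogenization.

(** * Critical pairs of letterplace words *)

Section CriticalPairs.
Local Open Scope ring_scope.
Local Open Scope classical_set_scope.
Variables (K : fieldType) (N : option nat).
Local Notation A := (xtvar N).
Local Notation W := {fmonom A}.
Local Notation X := {fmonom (xvar N)}.
Local Notation PM := {cmonom (A * nat)%type}.
Local Notation F := 'F[K, N].
Local Notation Fbar := 'Fbar[K, N].
Local Notation Pbar := 'Pbar[K, N].
Variable lt : {cmonom A} -> {cmonom A} -> Prop.
Hypothesis lt_ordering : monomial_ordering lt.
Hypothesis lt_variables : ordered_variables lt.
Local Notation lmw := (lm (@word_lt N)).
Local Notation lcw := (lc (@word_lt N)).
Local Notation "u · v" := (mmul u v) (at level 40, left associativity).
Implicit Types (f g : Fbar) (G : set Fbar).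

(** phi on words. *)
Definition erase_t (w : W) : X := FMonom (pmap id w).

Lemma erase_tM (u v : W) : erase_t (u · v) = erase_t u · erase_t v.
Proof. by apply/eqP; rewrite fmP fmM /= fmM pmap_cat. Qed.

Lemma phiE f : phi f = relabel erase_t f.
Proof.
rewrite /phi /falg_eval /mmap relabel.unlock; apply: eq_bigr => w _.
suff -> : \prod_(y <- w) (if y is Some i then xF K i else 1) = << erase_t w >>.
  by rewrite mulUU mul1m mulr1.
rewrite -{2}(fmK w); elim: (w : seq A) => [|y s IH].
  have -> : erase_t (FMonom [::]) = mone by apply/eqP; rewrite fmP fm1.
  exact: big_nil.
rewrite big_cons IH; case: y => [i|]; last by rewrite mul1r.
by rewrite mulUU mulr1; congr << _ >>; apply/eqP; rewrite fmP fmM fmU.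
Qed.

Lemma phi_sandwich (u v : W) f :
  phi (sandwich u v f) = sandwich (erase_t u) (erase_t v) (phi f).
Proof.
rewrite !phiE /sandwich !relabel_comp; apply: eq_relabel => w _ /=.
by rewrite !erase_tM.
Qed.

(** phi is multiplicative, so it maps each product u g v into the ideal I. *)
Lemma Span_phi (I : set F) G P f : ideal I -> (forall g, G g -> I (phi g)) ->
  Span (@word_lt N) G P f -> I (phi f).
Proof.
move=> [I0 ID IM] GI; elim=> [|c u g v {}f Gg _ _ If].
  by rewrite phiE relabel0.
have -> : phi (c *: sandwich u v g + f) = phi (c *: sandwich u v g) + phi f.
  by rewrite !phiE relabelD.
apply: (ID _ _ _ If); have -> : phi (c *: sandwich u v g) =
    << c *g erase_t u >> * phi g * << erase_t v >>.
  by rewrite mulU_sandwich mulr1 -phi_sandwich !phiE relabelZ.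
exact/IM/GI.
Qed.

Definition t_commutator (i : xvar N) : Fbar :=
  tFbar K N * yFbar K (Some i) - yFbar K (Some i) * tFbar K N.

Lemma t_commutatorE i : t_commutator i =
  << FMonom [:: None; Some i] >> - << FMonom [:: Some i; None] >>.
Proof.
have fmu2 (y z : A) : mmul (fmu y) (fmu z) = FMonom [:: y; z] :> W.
  by apply/eqP; rewrite fmP fmM !fmU.
by rewrite /t_commutator /tFbar /yFbar !mulUU mulr1 !fmu2.
Qed.

Lemma mcoeff_t_commutator i :
  (t_commutator i)@_(FMonom [:: None; Some i]) = 1.
Proof. by rewrite t_commutatorE; apply: mcoeffUB. Qed.

Lemma t_commutator_supp i n : n \in msupp (t_commutator i) ->
  n = FMonom [:: None; Some i] \/ n = FMonom [:: Some i; None].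
Proof.
rewrite t_commutatorE => /(fsubsetP (msuppB_le _ _)); rewrite in_fsetU.
by case/orP => /(fsubsetP msuppU_le); rewrite inE => /eqP; [left | right].
Qed.

Lemma t_commutator_neq0 i : t_commutator i <> 0.
Proof.
move=> e; have := mcoeff_t_commutator i; rewrite e mcoeff0 => /esym/eqP.
by rewrite oner_eq0.
Qed.

Lemma t_commutator_homogeneous i : homogeneous 2 (t_commutator i).
Proof. by move=> n /t_commutator_supp [] ->. Qed.

Lemma lm_t_commutator i : lmw (t_commutator i) = FMonom [:: None; Some i].
Proof.
apply: (lmw_unique (@word_lt_ordering N)).
  by rewrite -mcoeff_neq0 mcoeff_t_commutator oner_neq0.
move=> n /t_commutator_supp [-> //|-> _].
exact: (@deg_rlex_split _ (@letter_rank N) [:: Some i] [:: None] [::] None (Some i)).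
Qed.

Lemma phi_t_commutator i : phi (t_commutator i) = 0.
Proof.
rewrite phiE t_commutatorE (relabelUB K erase_t).
by rewrite (_ : erase_t (FMonom [:: None; Some i]) = erase_t (FMonom [:: Some i; None])) ?subrr.
Qed.

(** The invariant of the elements of the basis. For the second disjunct of the
third clause the leading word is t x, which does not occur in a word of X
followed by a power of t. *)
Definition admissible (I : set F) f : Prop :=
  [/\ f <> 0, exists d, homogeneous d f,
      all isSome (lmw f) \/ (exists i, f = t_commutator i) & I (phi f)].

(** The part of [overlap_resolved] that concerns the shift k. *)
Definition overlap_resolved_at G g g' k : Prop := forall u z v v' : W,
  size u = k -> lmw g = u · z -> z <> mone -> lmw g' <> mone ->
  lmw g · v = u · lmw g' · v' -> v = mone \/ v' = mone ->
  Span (@word_lt N) G (fun n => word_lt n (lmw g · v))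
    ((lcw g)^-1 *: sandwich mone v g - (lcw g')^-1 *: sandwich u v' g').

Lemma word_neq1 (w : W) : w <> mone -> exists y s, w = y :: s :> seq A.
Proof.
move=> w1; case e: (w : seq A) => [|y s]; last by exists y, s.
by case: w1; apply/eqP; rewrite fmP e fm1.
Qed.

(** In an overlap or an inclusion every place of the common multiple belongs to
one of the two words, and they agree at the places that belong to both. *)
Lemma lcm_overlap (a b u z v v' : W) : a = u · z -> a · v = u · b · v' ->
  v = mone \/ v' = mone -> lcmcm (pword 0 a) (pword (size u) b) = pword 0 (a · v).
Proof.
move=> az e vv; apply: cm_ext => -[y j]; rewrite lcmcmE.
case: vv => [v1|v1]; rewrite v1 mulm1 in e *.
  rewrite e pword_sandwich !cmM; apply/maxn_idPl; lia.
rewrite e az; have bz : b = z · v.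
  by apply: (mulm_injl (@word_lt_ordering N) (p := u)); rewrite -e az mulmA.
rewrite bz mulmA pword_sandwich !fmM !pword_cat !cmM add0n !pwordE.
case: (ltnP j (size u)) => uj; first by rewrite (leqNgt (size u + _)); lia.
by rewrite leq0n /= !add0n; apply/maxn_idPr/leq_addr.
Qed.

Lemma gcd_overlap (a b u z v v' : W) : a = u · z -> z <> mone -> b <> mone ->
  a · v = u · b · v' -> gcdcm (pword 0 a) (pword (size u) b) <> mone.
Proof.
move=> az /word_neq1 [y [s zE]] /word_neq1 [y' [s' bE]] e g1.
have e' : z · v = b · v'.
  by apply: (mulm_injl (@word_lt_ordering N) (p := u)); rewrite !mulmA -az.
have yy : y' = y.
  by have := congr1 (@fmonom_val A) e'; rewrite !fmM zE bE => -[].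
have := congr1 (fun m : PM => m (y, size u)) g1.
rewrite gcdcmE cm1 az fmM !pwordE size_cat add0n leqnn subnn subn0 zE bE /= yy.
by rewrite nth_cat ltnn subnn eqxx addnS ltnS leq_addr addnS ltnS leq_addr.
Qed.

Lemma pword_Lbar (w : W) : Lbar (<< pword 0 w >> : Pbar).
Proof.
exists (size w) => //; exists << w >>.
  by move=> n /(fsubsetP msuppU_le); rewrite inE => /eqP->.
by rewrite letterplaceE relabelU.
Qed.

Lemma LbarP (m : PM) : Lbar (<< m >> : Pbar) -> exists w : W, m = pword 0 w.
Proof.
move=> [d _ [f _]]; rewrite letterplace_lp => fm.
have : m \in msupp (letterplace_at 0 f).
  by rewrite fm -mcoeff_neq0 mcoeffUU oner_neq0.
by case/msupp_lp => w _ ->; exists w.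
Qed.

Section Pair.
Variables (g g' : Fbar) (d d' : nat).
Hypotheses (g0 : g <> 0) (g'0 : g' <> 0).
Hypotheses (gh : homogeneous d g) (g'h : homogeneous d' g').

Lemma critical_overlap (u z v v' : W) :
  lmw g = u · z -> z <> mone -> lmw g' <> mone ->
  lmw g · v = u · lmw g' · v' -> v = mone \/ v' = mone ->
  critical lt (letterplace g) (letterplace g') (size u).
Proof.
move=> gz z1 g1 e vv; rewrite /critical shift_letterplace letterplace_lp.
rewrite (lm_lp lt_ordering lt_variables 0 g0 gh).
rewrite (lm_lp lt_ordering lt_variables _ g'0 g'h); split.
  exact: gcd_overlap gz z1 g1 e.
by rewrite (lcm_overlap gz e vv); exact: pword_Lbar.
Qed.

(** Both leading words divide the word that is their lcm; the first one is a
prefix and the second one starts at place k because neither is empty. *)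
Lemma critical_words k : critical lt (letterplace g) (letterplace g') k ->
  exists u v v' : W, [/\ size u = k, lmw g · v = u · lmw g' · v' &
    lcmcm (pword 0 (lmw g)) (pword k (lmw g')) = pword 0 (lmw g · v)].
Proof.
rewrite /critical shift_letterplace letterplace_lp.
rewrite (lm_lp lt_ordering lt_variables 0 g0 gh).
rewrite (lm_lp lt_ordering lt_variables _ g'0 g'h) => -[gcd1 /LbarP [w lw]].
have dvdl : dvdcm (pword 0 (lmw g)) (pword 0 w).
  exists (divcm (pword 0 w) (pword 0 (lmw g))); apply: cm_ext => p.
  by rewrite cmM divcmE -lw lcmcmE; lia.
have dvdr : dvdcm (pword k (lmw g')) (pword 0 w).
  exists (divcm (pword 0 w) (pword k (lmw g'))); apply: cm_ext => p.
  by rewrite cmM divcmE -lw lcmcmE; lia.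
have [u0 [v [w1 s0 _]]] := pword_dvd dvdl.
have [u [v' [w2 sk _]]] := pword_dvd dvdr.
have gn1 : lmw g <> mone.
  move=> e; apply: gcd1; apply: cm_ext => p.
  by rewrite gcdcmE e fm1 pword_nil cm1 min0n.
have g'n1 : lmw g' <> mone.
  move=> e; apply: gcd1; apply: cm_ext => p.
  by rewrite gcdcmE e fm1 pword_nil cm1 minn0.
have u01 : u0 = mone.
  by apply/eqP; rewrite fmP fm1; apply/eqP/size0nil/s0.
rewrite u01 mul1m in w1; exists u, v, v'; split; first exact: sk.
  by rewrite -w1 -w2.
by rewrite lw w1.
Qed.

Lemma spoly_lp (u v v' : W) : lmw g · v = u · lmw g' · v' ->
  lcmcm (pword 0 (lmw g)) (pword (size u) (lmw g')) = pword 0 (lmw g · v) ->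
  spoly (place_lt lt) (letterplace g) (shift (size u) (letterplace g')) =
  letterplace_at 0 ((lcw g)^-1 *: sandwich mone v g - (lcw g')^-1 *: sandwich u v' g').
Proof.
move=> e lcmE; rewrite /spoly shift_letterplace letterplace_lp.
rewrite (lm_lp lt_ordering lt_variables 0 g0 gh).
rewrite (lm_lp lt_ordering lt_variables _ g'0 g'h).
rewrite (lc_lp lt_ordering lt_variables 0 g0 gh).
rewrite (lc_lp lt_ordering lt_variables _ g'0 g'h) lcmE.
set c := (lcw g)^-1; set c' := (lcw g')^-1.
have e1 : << c *g divcm (pword 0 (lmw g · v)) (pword 0 (lmw g)) >> * letterplace_at 0 g =
    letterplace_at 0 (c *: sandwich mone v g).
  apply: mul_lp => n ng; have := @pword_div N mone (lmw g) v n.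
  rewrite fm1 mul1m; apply.
  by rewrite (gh ng) (gh (lm_supp (@word_lt_ordering N) g0)).
have e2 : << c' *g divcm (pword 0 (lmw g · v)) (pword (size u) (lmw g')) >> *
    letterplace_at (size u) g' = letterplace_at 0 (c' *: sandwich u v' g').
  apply: mul_lp => n ng; rewrite e; apply: pword_div.
  by rewrite (g'h ng) (g'h (lm_supp (@word_lt_ordering N) g'0)).
have -> : letterplace_at 0 (c *: sandwich mone v g - c' *: sandwich u v' g') =
    letterplace_at 0 (c *: sandwich mone v g) - letterplace_at 0 (c' *: sandwich u v' g').
  exact: relabelB.
exact: (f_equal2 (fun a b : Pbar => a - b) e1 e2).
Qed.

Lemma spoly_supp (u v v' : W) : lmw g · v = u · lmw g' · v' ->
  forall n, n \in msupp
    ((lcw g)^-1 *: sandwich mone v g - (lcw g')^-1 *: sandwich u v' g') ->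
  size n = size (lmw g · v) /\ word_lt n (lmw g · v).
Proof.
move=> e n neta; split; last first.
  have := @spoly_lt K _ _ (@word_lt_ordering N) g g' mone v u v' n g0 g'0.
  by rewrite !mul1m => /(_ e neta).
have lg := lm_supp (@word_lt_ordering N) g0.
have lg' := lm_supp (@word_lt_ordering N) g'0.
move/(fsubsetP (msuppB_le _ _)): neta; rewrite in_fsetU => /orP[].
  move/(fsubsetP (msuppZ_le _ _))/sandwich_supp => [m mg ->].
  by rewrite mul1m !fmM !size_cat (gh mg) (gh lg).
move/(fsubsetP (msuppZ_le _ _))/sandwich_supp => [m mg ->].
by rewrite e !fmM !size_cat (g'h mg) (g'h lg').
Qed.
End Pair.
End CriticalPairs.

(** * Invariant of the algorithm *)

Section TreatStep.
Local Open Scope ring_scope.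
Local Open Scope classical_set_scope.
Variables (K : fieldType) (N : option nat).
Local Notation A := (xtvar N).
Local Notation W := {fmonom A}.
Local Notation X := {fmonom (xvar N)}.
Local Notation F := 'F[K, N].
Local Notation Fbar := 'Fbar[K, N].
Local Notation Pbar := 'Pbar[K, N].
Local Notation state := (set Pbar * set (Pbar * Pbar))%type.
Variable lt : {cmonom A} -> {cmonom A} -> Prop.
Hypothesis lt_ordering : monomial_ordering lt.
Hypothesis lt_variables : ordered_variables lt.
Local Notation lmw := (lm (@word_lt N)).
Local Notation "u · v" := (mmul u v) (at level 40, left associativity).
Local Notation lpG G := [set letterplace f | f in G].
Implicit Types (f g : Fbar) (G : set Fbar).

Definition t_power k : W := FMonom (nseq k None).

Lemma irreducible_normal (w : W) :
  (forall k i, ~ dvdcm (pword k (lmw (t_commutator K i))) (pword 0 w)) ->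
  exists (s : X) k, w = FMonom (map Some s) · t_power k.
Proof.
move=> irr; case: (@normal_word N w) => [u i z wE|s [k wE]].
  apply: (irr (size u) i); rewrite lm_t_commutator wE.
  exists (mmul (pword 0 u) (pword (size u + 2) z)).
  rewrite -[[:: None, _ & z]]/([:: None; Some i] ++ z) !pword_cat.
  by rewrite mulmA (mulmC (pword 0 u)) -mulmA.
by exists (FMonom s), k; apply/eqP; rewrite fmP fmM wE.
Qed.

(** An irreducible leading word consists of letters of X followed by t^k, and the
smaller words of the same length inherit the suffix t^k. So r = g t^k, and psi
followed by multihomogenization removes just this factor. *)
Lemma rehomogenize d (r : Fbar) : r <> 0 -> homogeneous d r ->
  (forall k i, ~ dvdcm (pword k (lmw (t_commutator K i))) (pword 0 (lmw r))) ->
  exists g k, [/\ g <> 0, exists e, homogeneous e g, all isSome (lmw g),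
    r = sandwich mone (t_power k) g &
    multihomog (psi (letterplace r)) = letterplace g].
Proof.
move=> r0 rh /irreducible_normal [s [k wE]].
have lr := lm_supp (@word_lt_ordering N) r0.
set w1 := FMonom (map Some s) in wE.
(* All words of r end in t^k, so r is recovered from its truncations. *)
pose cut (n : W) : W := FMonom (take (size w1) n).
have cutK (n : W) : n \in msupp r -> cut n · t_power k = n.
  move=> nr; apply/eqP; rewrite fmP fmM /=; apply/eqP/esym.
  apply: (@normal_word_lower N n (lmw r)).
  - by rewrite (rh _ nr) (rh _ lr).
  - by rewrite wE fmM.
  - exact: (lm_max (@word_lt_ordering N) r0 nr).
pose g := relabel cut r.
have rE : r = sandwich mone (t_power k) g.
  rewrite /sandwich /g relabel_comp; apply/esym/relabel_id => n nr /=.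
  by rewrite mul1m cutK.
have g0 : g <> 0 by move=> e; apply: r0; rewrite rE e /sandwich relabel0.
have lg : lmw g = w1.
  have := lm_sandwich (@word_lt_ordering N) mone (t_power k) g0.
  rewrite -rE wE mul1m -[w1]mul1m -[lmw g]mul1m.
  by move/(sandwich_inj (@word_lt_ordering N)) => <-; rewrite mul1m.
have wX : all isSome (lmw g) by rewrite lg; apply/allP => y /mapP[i _ ->].
have gh : homogeneous (size w1) g.
  move=> n /msupp_relabel [m mr ->] /=; rewrite size_takel //.
  by rewrite (rh _ mr) -(rh _ lr) wE fmM size_cat leq_addr.
exists g, k; split=> //; first by exists (size w1).
rewrite psi_lp -(multihomog_t_free_part gh (lm_supp (@word_lt_ordering N) g0) wX).
congr multihomog; rewrite {1}rE /sandwich relabel_comp; apply: eq_relabel => n _ /=.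
by rewrite mul1m fmM t_free_part_pad.
Qed.

Lemma erase_t_power k : erase_t (t_power k) = mone.
Proof. by apply/eqP; rewrite fmP fm1 /=; elim: k. Qed.

Lemma phi_t_power k f : phi (sandwich mone (t_power k) f) = phi f.
Proof.
rewrite phi_sandwich erase_t_power; apply: relabel_id => n _ /=.
rewrite mulm1 (_ : erase_t mone = mone) ?mul1m //.
by apply/eqP; rewrite fmP /= !fm1.
Qed.

Variables (I : set F) (idealI : ideal I).

Definition basis_invariant G : Prop :=
  (forall g, G g -> admissible I g) /\ (forall i, G (t_commutator K i)).

Lemma basis_proper G : basis_invariant G -> homogeneous_basis G.
Proof. by move=> [adm _] g /adm [g0 gh _ _]; split. Qed.

Lemma resolved_at_sub G G' g g' k : G `<=` G' ->
  overlap_resolved_at G g g' k -> overlap_resolved_at G' g g' k.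
Proof.
move=> GG R u z v v' uk gz z1 g1 e vv.
exact: Span_sub GG (fun _ h => h) (R u z v v' uk gz z1 g1 e vv).
Qed.

Definition new_pairs G G' (B' : set (Pbar * Pbar)) : Prop := forall g g',
  G' g -> G' g' -> G g /\ G g' \/ B' (letterplace g, letterplace g').

(** A zero remainder is itself the certificate that the S-polynomial is resolved.
Otherwise the remainder is f t^k with f the new element, so the new basis
resolves the pair, and all the pairs that contain f are scheduled. *)
Lemma treat_invariant g g' k (s s' : state) G : basis_invariant G ->
  s.1 = lpG G -> G g -> G g' ->
  critical lt (letterplace g) (letterplace g') k ->
  treat lt (letterplace g) (letterplace g') k s s' ->
  exists G', [/\ basis_invariant G', s'.1 = lpG G', G `<=` G',
    s.2 `<=` s'.2 & overlap_resolved_at G' g g' k /\ new_pairs G G' s'.2].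
Proof.
move=> Ginv s1 Gg Gg' crit; have [adm Gt] := Ginv.
have [g0 [d gh] _ _] := adm _ Gg; have [g'0 [d' g'h] _ _] := adm _ Gg'.
have [u [v [v' [uk e lcmE]]]] := critical_words lt_ordering lt_variables g0 g'0 gh g'h crit.
rewrite -uk in lcmE.
have spE := spoly_lp lt_ordering lt_variables g0 g'0 gh g'h e lcmE.
have spS := spoly_supp g0 g'0 gh g'h e.
rewrite uk in spE lcmE; set w := lmw g · v in e lcmE spS.
set eta := _ - _ in spE spS.
have SG : Span (@word_lt N) G (fun=> True) eta.
  apply: SpanB; first exact: Span_gen.
  exact: Span_gen.
have at_eta G' : Span (@word_lt N) G' (fun n => word_lt n w) eta ->
    overlap_resolved_at G' g g' k.
  move=> sp u1 z v1 v1' u1k gz z1 g1 e1 vv.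
  have l1 := lcm_overlap gz e1 vv; rewrite u1k lcmE in l1.
  have e2 : lmw g · v = lmw g · v1 := pwordW_inj l1.
  (* The lcm determines the word of the overlap, so the factors are those of w. *)
  have e3 := mulm_injl (@word_lt_ordering N) e2.
  have [u1E v1E] : u = u1 /\ v' = v1'.
    move: e1; rewrite -e2 -/w e -!mulmA => /(congr1 (@fmonom_val A)); rewrite !fmM.
    move=> /eqP; rewrite eqseq_cat ?uk ?u1k // => /andP[/eqP uu].
    rewrite eqseq_cat // => /andP[_ /eqP vv'].
    by split; apply/eqP; rewrite fmP ?uu ?vv'.
  by rewrite -e3 -u1E -v1E.
have red r : Reduce (place_lt lt) (shift_set s.1)
    (spoly (place_lt lt) (letterplace g) (shift k (letterplace g'))) r ->
  exists rho, [/\ r = letterplace_at 0 rho, homogeneous (size w) rho,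
    (forall n, n \in msupp rho -> word_lt n w),
    Span (@word_lt N) G (fun n => word_lt n w) (eta - rho) &
    rho <> 0 -> forall k g, G g -> ~ dvdcm (pword k (lmw g)) (pword 0 (lmw rho))].
  rewrite s1 => rr.
  have R := Reduce_lp lt_ordering lt_variables (basis_proper Ginv) rr spE.
  by apply: R => n /spS[].
case=> [/red|h /red [rho [hE rh rsmall sp irr]] h0].
  move=> [rho [/esym/lp_eq0 r0 _ _ sp _]].
  exists G; split=> //; split; last by move=> ? ?; left.
  by apply: at_eta; rewrite r0 subr0 in sp.
have r0 : rho <> 0 by move=> r0; apply: h0; rewrite hE r0 /letterplace_at relabel0.
have [f [j [f0 fh fX rE fE]]] := rehomogenize r0 rh (fun k i => irr r0 k _ (Gt i)).
have hf : multihomog (psi h) = letterplace f by rewrite hE -letterplace_lp.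
rewrite hf.
have If : I (phi f).
  rewrite -(phi_t_power j) -rE.
  have SR : Span (@word_lt N) G (fun=> True) rho.
    have -> : rho = eta - (eta - rho) by rewrite opprB addrCA subrr addr0.
    by apply: SpanB => //; apply: Span_sub sp.
  apply: (Span_phi idealI _ SR) => a /adm [_ _ _ Ia]; exact: Ia.
exists (G `|` [set f]); split.
- split=> [a [/adm //|->]|i]; last by left; exact: Gt.
  by split=> //; left.
- by rewrite /= image_setU image_set1 s1.
- by move=> a Ga; left.
- by move=> p Bp; left.
split.
  (* The remainder is a multiple of the new element, below the overlap. *)
  apply: at_eta; have -> : eta = (eta - rho) + rho by rewrite subrK.
  apply: SpanD; first by apply: Span_sub sp => // a Ga; left.
  rewrite rE -[sandwich _ _ _]scale1r.
  apply: Span_gen; first by right.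
  rewrite -(lm_sandwich (@word_lt_ordering N)) // -rE.
  exact: rsmall (lm_supp (@word_lt_ordering N) r0).
have memG c : G c -> s.1 (letterplace c).
  by move=> Gc; rewrite s1; exists c; [exact: Gc | exact: erefl].
move=> a b [Ga|->] [Gb|->]; [by left | right; right..].
- by right; exists (letterplace a); [exact: memG | exact: erefl].
- by left; right; exists (letterplace b); [exact: memG | exact: erefl].
- by left; left.
Qed.
End TreatStep.

Section MainLoop.
Local Open Scope ring_scope.
Local Open Scope classical_set_scope.
Variables (K : fieldType) (N : option nat).
Local Notation A := (xtvar N).
Local Notation F := 'F[K, N].
Local Notation Fbar := 'Fbar[K, N].
Local Notation Pbar := 'Pbar[K, N].
Local Notation state := (set Pbar * set (Pbar * Pbar))%type.
Variable lt : {cmonom A} -> {cmonom A} -> Prop.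
Hypothesis lt_ordering : monomial_ordering lt.
Hypothesis lt_variables : ordered_variables lt.
Local Notation lpG G := [set letterplace f | f in G].
Implicit Types (f g : Fbar) (G : set Fbar).


Variables (I : set F) (idealI : ideal I).

Lemma treat_all_invariant g g' l (s s' : state) :
  treat_all lt (letterplace g) (letterplace g') l s s' ->
  forall G, basis_invariant I G -> s.1 = lpG G -> G g -> G g' ->
  (forall k, k \in l -> critical lt (letterplace g) (letterplace g') k) ->
  exists G', [/\ basis_invariant I G', s'.1 = lpG G', G `<=` G',
    s.2 `<=` s'.2 & (forall k, k \in l -> overlap_resolved_at G' g g' k) /\
    new_pairs G G' s'.2].
Proof.
elim=> {l s s'} [s|k l s1 s2 s3 tr _ IH] G Ginv s1E Gg Gg' crit.
  by exists G; split=> //; split=> // a b Ga Gb; left.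
have kl : k \in k :: l by rewrite inE eqxx.
have [G1 [G1inv s2E GG1 B12 [R1 new1]]] :=
  treat_invariant lt_ordering lt_variables idealI Ginv s1E Gg Gg' (crit k kl) tr.
have crit' j : j \in l -> critical lt (letterplace g) (letterplace g') j.
  by move=> jl; apply: crit; rewrite inE jl orbT.
have [G2 [G2inv s3E GG2 B23 [R2 new2]]] :=
  IH G1 G1inv s2E (GG1 _ Gg) (GG1 _ Gg') crit'.
exists G2; split=> //.
- by move=> a /GG1 /GG2.
- by move=> p /B12 /B23.
split=> [j|a b Ga Gb].
  rewrite inE => /orP[/eqP->|/R2 //]; exact: resolved_at_sub GG2 R1.
have [[G1a G1b]|Bab] := new2 a b Ga Gb; last by right.
by have [|Bab] := new1 a b G1a G1b; [left | right; apply: B23].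
Qed.

Definition closed_pairs (s : state) : Prop :=
  forall p, s.2 p -> s.1 p.1 /\ s.1 p.2.

Lemma treat_closed (f g : Pbar) k (s s' : state) : treat lt f g k s s' ->
  closed_pairs s -> closed_pairs s'.
Proof.
case=> // h _ _ cl p /= [/cl[p1 p2]|[[->|[c sc <-]]|[c sc <-]]];
  by split; (by left) || (by right).
Qed.

Lemma treat_all_closed (f g : Pbar) l (s s' : state) : treat_all lt f g l s s' ->
  closed_pairs s -> closed_pairs s'.
Proof. by elim=> // {}k {}l s1 s2 s3 /treat_closed h _ IH /h /IH. Qed.

Lemma letterplace_inj f g : letterplace f = letterplace g -> f = g.
Proof. by rewrite !letterplace_lp => /lp_inj. Qed.

(** At each moment a pair of basis elements is either waiting or resolved; at the
end none is waiting. *)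
Lemma main_loop_invariant (s : state) R : main_loop lt s R ->
  forall G, basis_invariant I G -> s.1 = lpG G -> closed_pairs s ->
  (forall g g', G g -> G g' -> s.2 (letterplace g, letterplace g') \/
     overlap_resolved (@word_lt N) G g g') ->
  exists G', [/\ basis_invariant I G', R = lpG G', G `<=` G' &
    forall g g', G' g -> G' g' -> overlap_resolved (@word_lt N) G' g g'].
Proof.
elim=> {s R} [R|R B f0 g0 l s R' B0 _ lcrit tr _ IH] G Ginv sE cl pairs.
  exists G; split=> // g g' Gg Gg'; by case: (pairs _ _ Gg Gg').
have [/= f0R g0R] := cl _ B0; simpl in sE; rewrite sE in f0R g0R.
case: f0R B0 lcrit tr => f Gf <- B0 lcrit tr.
case: g0R B0 lcrit tr => g Gg <- B0 lcrit tr.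
have crit k : k \in l -> critical lt (letterplace f) (letterplace g) k.
  by move=> /lcrit.
have [G' [G'inv s'E GG' BB' [res new]]] :=
  treat_all_invariant tr Ginv sE Gf Gg crit.
have [|a b Ga Gb|G2 [G2inv RE GG2 res2]] := IH G' G'inv s'E.
- by apply: treat_all_closed tr _ => p [/cl].
- have [[Ga' Gb']|Bab] := new _ _ Ga Gb; last by left.
  have [Bab|ov] := pairs _ _ Ga' Gb'; last first.
    right=> u z v v' az z1 b1 e vv.
    exact: Span_sub GG' (fun _ h => h) (ov u z v v' az z1 b1 e vv).
  have [e|ne] := pselect ((letterplace a, letterplace b) = (letterplace f, letterplace g)).
    rewrite (letterplace_inj (congr1 fst e)) (letterplace_inj (congr1 snd e)).
    right=> u z v v' fz z1 g1 fv vv.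
    have [fn [d fh] _ _] := G'inv.1 _ (GG' _ Gf).
    have [gn [d' gh] _ _] := G'inv.1 _ (GG' _ Gg).
    have ul : size u \in l.
      apply/lcrit.
      exact: (critical_overlap lt_ordering lt_variables fn gn fh gh fz z1 g1 fv vv).
    exact: (res _ ul u z v v' erefl fz z1 g1 fv vv).
  by left; apply: BB'; split.
exists G2; split=> //; by move=> a /GG' /GG2.
Qed.
End MainLoop.

(** * Homogenization to a given degree *)

Lemma partition_sum (V : nmodType) (T : Type) (s : seq T) (d : T -> nat) n
    (E : nat -> T -> V) : all (fun w => d w < n)%N s ->
  (\sum_(k < n) \sum_(w <- s | d w == k) E k w = \sum_(w <- s) E (d w) w)%R.
Proof.
move=> dn; rewrite (eq_bigr (fun k : 'I_n =>
    \sum_(w <- s) if d w == k then E k w else 0)%R); last first.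
  by move=> k _; rewrite big_mkcond.
rewrite exchange_big /=; elim: s dn => [|w s IH] /=; first by rewrite !big_nil.
move=> /andP[wn sn]; rewrite !big_cons IH //; congr (_ + _)%R.
rewrite (bigD1 (Ordinal wn)) //= eqxx big1 ?addr0 // => k kw.
by rewrite ifN //; apply: contra kw => /eqP e; apply/eqP/val_inj.
Qed.

Section Homogenization.
Local Open Scope ring_scope.
Local Open Scope classical_set_scope.
Variables (K : fieldType) (N : option nat).
Local Notation A := (xtvar N).
Local Notation W := {fmonom A}.
Local Notation X := {fmonom (xvar N)}.
Local Notation F := 'F[K, N].
Local Notation Fbar := 'Fbar[K, N].
Local Notation lmw := (lm (@word_lt N)).
Local Notation lmF := (lm (@grrlex_lt N)).
Local Notation "u · v" := (mmul u v) (at level 40, left associativity).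

Definition xword (n : X) : W := FMonom (map Some n).

(** The subtraction is truncated: a word longer than D is left as it is. *)
Definition pad_word D (n : X) : W := xword n · t_power N (D - size n).

Definition homog_at D (f : F) : Fbar := relabel (pad_word D) f.

Lemma grrlex_ordering : monomial_ordering (@grrlex_lt N).
Proof.
rewrite grrlex_ltE; have inj : injective (fun i : xvar N => val i) by exact: val_inj.
split.
- exact: deg_rlex_irr.
- exact: deg_rlex_trans.
- exact: deg_rlex_total.
- by move=> m n p q; apply: deg_rlex_mul.
- exact: deg_rlex_wf.
Qed.

Lemma erase_t_xword (n : X) : erase_t (xword n) = n.
Proof.
apply/eqP; rewrite fmP /=; apply/eqP; elim: (n : seq _) => //= i s ->; done.
Qed.

Lemma erase_t_pad D (n : X) : erase_t (pad_word D n) = n.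
Proof. by rewrite erase_tM erase_t_power mulm1 erase_t_xword. Qed.

Lemma xwordM (m n : X) : xword (m · n) = xword m · xword n.
Proof. by apply/eqP; rewrite fmP fmM /= fmM map_cat. Qed.

Lemma t_powerD j k : t_power N (j + k) = t_power N j · t_power N k.
Proof. by apply/eqP; rewrite fmP fmM /= nseqD. Qed.

Lemma size_pad D (n : X) : (size n <= D)%N -> size (pad_word D n) = D.
Proof. by move=> le; rewrite fmM size_cat /= size_map size_nseq subnKC. Qed.

(** A shorter word is padded with t where the longer one still has a variable of
X, so comparing padded words compares degrees first, as on F. *)
Lemma pad_lt D (m n : X) : (size n <= D)%N -> grrlex_lt m n ->
  word_lt (pad_word D m) (pad_word D n).
Proof.
move=> nD [mn|[mn [a [b [c [x [y [mE nE ab xy]]]]]]]]; rewrite !fdegE in mn.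
  case/lastP nE : (n : seq _) => [|s y]; first by rewrite nE in mn.
  rewrite nE size_rcons in mn nD.
  have -> : pad_word D n = FMonom (map Some s ++ Some y :: nseq (D - (size s).+1) None).
    by apply/eqP; rewrite fmP fmM /= nE map_rcons size_rcons cat_rcons.
  have -> : pad_word D m = FMonom ((map Some m ++ nseq (size s - size m) None)
      ++ None :: nseq (D - (size s).+1) None).
    apply/eqP; rewrite fmP fmM /= -catA; apply/eqP; congr (_ ++ _).
    rewrite -[_ :: nseq _ _]/(nseq (D - (size s).+1).+1 None) -nseqD.
    by congr nseq; move: (size m) (size s) mn nD => p q; lia.
  apply: deg_rlex_split => //; rewrite size_cat !size_map size_nseq.
  by rewrite subnKC // -ltnS.
have {}mn : size m = size n by rewrite -!fdegE.
rewrite /pad_word mn -[xword m]mul1m -[xword n]mul1m; apply: deg_rlex_mul.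
have -> : xword m = FMonom (map Some a ++ Some x :: map Some c).
  by apply/eqP; rewrite fmP /= mE map_cat.
have -> : xword n = FMonom (map Some b ++ Some y :: map Some c).
  by apply/eqP; rewrite fmP /= nE map_cat.
by apply: deg_rlex_split => //; rewrite !size_map.
Qed.

Lemma mcoeff_homog_at D f (n : X) : (homog_at D f)@_(pad_word D n) = f@_n.
Proof.
apply: (mcoeff_relabel (s := pad_word D)) => m _ e.
by rewrite -(erase_t_pad D m) e erase_t_pad.
Qed.

Lemma lm_homog_at D (f : F) : f <> 0 -> (forall n, n \in msupp f -> size n <= D)%N ->
  lmw (homog_at D f) = pad_word D (lmF f).
Proof.
move=> f0 small; have lf := lm_supp grrlex_ordering f0.
apply: (lmw_unique (@word_lt_ordering N)).
  by rewrite -mcoeff_neq0 mcoeff_homog_at mcoeff_neq0.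
move=> m /msupp_relabel [n nf ->] ne; apply: pad_lt; first exact: small.
by case: (lm_max grrlex_ordering f0 nf) => // e; case: ne; rewrite e.
Qed.

Lemma homog_at_homogeneous D (f : F) : (forall n, n \in msupp f -> size n <= D)%N ->
  homogeneous D (homog_at D f).
Proof. by move=> small m /msupp_relabel [n /small nD ->]; apply: size_pad. Qed.

Lemma phi_homog_at D (f : F) : phi (homog_at D f) = f.
Proof.
rewrite phiE /homog_at relabel_comp; apply: relabel_id => n _ /=.
exact: erase_t_pad.
Qed.

Lemma homog_at_neq0 D (f : F) : f <> 0 -> homog_at D f <> 0.
Proof. by move=> f0 e; apply: f0; rewrite -(phi_homog_at D f) e phiE relabel0. Qed.

Lemma topdeg_ge (f : F) (n : X) : n \in msupp f -> (size n <= topdeg f)%N.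
Proof. by move=> nf; apply: (leq_bigmax_seq (F := fun w : X => fdeg w)). Qed.

Lemma inclFE (f : F) : inclF f = relabel xword f.
Proof.
rewrite /inclF /falg_eval /mmap relabel.unlock; apply: eq_bigr => w _.
suff -> : \prod_(y <- w) yFbar K (Some y) = << xword w >> :> Fbar.
  by rewrite mulUU mul1m mulr1.
rewrite -(fmK w) /=; elim: (w : seq _) => [|y s IH].
  have -> : xword (FMonom [::]) = mone by apply/eqP; rewrite fmP fm1.
  exact: big_nil.
rewrite big_cons IH mulUU mulr1; congr << _ >>.
by apply/eqP; rewrite fmP fmM fmU.
Qed.

Lemma tFbarX k : tFbar K N ^+ k = << t_power N k >>.
Proof.
elim: k => [|k IH].
  by have -> : t_power N 0 = mone by apply/eqP; rewrite fmP fm1.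
rewrite exprS IH mulUU mulr1; congr << _ >>.
by apply/eqP; rewrite fmP fmM fmU.
Qed.

Lemma homogE (f : F) : homog f = homog_at (topdeg f) f.
Proof.
pose E k (w : X) : Fbar := << f@_w *g xword w · t_power N (topdeg f - k) >>.
transitivity (\sum_(k < (topdeg f).+1) \sum_(w <- msupp f | fdeg w == k) E k w).
  apply: eq_bigr => k _; rewrite inclFE tFbarX /hcomp relabel_sum mulr_suml.
  by apply: eq_bigr => w _; rewrite relabelU mulUU mulr1.
rewrite partition_sum; last by apply/allP => w /topdeg_ge.
by rewrite /homog_at relabel.unlock.
Qed.
End Homogenization.

(** * From the homogenized ideal back to the free algebra on X *)

Section Dehomogenization.
Local Open Scope ring_scope.
Local Open Scope classical_set_scope.
Variables (K : fieldType) (N : option nat).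
Local Notation A := (xtvar N).
Local Notation W := {fmonom A}.
Local Notation X := {fmonom (xvar N)}.
Local Notation F := 'F[K, N].
Local Notation Fbar := 'Fbar[K, N].
Local Notation lmw := (lm (@word_lt N)).
Local Notation lmF := (lm (@grrlex_lt N)).
Local Notation "u · v" := (mmul u v) (at level 40, left associativity).

Section Commutation.
Variable G : set Fbar.
Hypothesis Gt : forall i, G (t_commutator K i).

(** Equality of words modulo the ideal generated by G. *)
Definition congruent (a b : W) : Prop :=
  Span (@word_lt N) G (fun=> True) (<< a >> - << b >> : Fbar).

Lemma congruent_refl a : congruent a a.
Proof. by rewrite /congruent subrr; left. Qed.

Lemma congruent_trans a b c : congruent a b -> congruent b c -> congruent a c.
Proof.
rewrite /congruent => ab bc.
have -> : << a >> - << c >> = (<< a >> - << b >>) + (<< b >> - << c >>) :> Fbar.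
  by rewrite addrA subrK.
exact: SpanD.
Qed.

Lemma congruent_mul p q a b : congruent a b -> congruent (p · a · q) (p · b · q).
Proof.
move/(Span_sandwich (P' := fun=> True) (p := p) (q := q)) => h.
by rewrite /congruent -(relabelUB K (fun w => p · w · q)); apply: h.
Qed.

Lemma congruent_swap1 i :
  congruent (t_power N 1 · xword (fmu i)) (xword (fmu i) · t_power N 1).
Proof.
rewrite /congruent.
have -> : t_power N 1 · xword (fmu i) = FMonom [:: None; Some i].
  by apply/eqP; rewrite fmP fmM /= fmU.
have -> : xword (fmu i) · t_power N 1 = FMonom [:: Some i; None].
  by apply/eqP; rewrite fmP fmM /= fmU.
rewrite -t_commutatorE -[t_commutator K i](relabel_id (s := fun w => mone · w · mone)); last first.
  by move=> n _; rewrite mulm1 mul1m.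
by rewrite -[relabel _ _]scale1r; apply: Span_gen.
Qed.

Lemma congruent_t_power_x k i :
  congruent (t_power N k · xword (fmu i)) (xword (fmu i) · t_power N k).
Proof.
elim: k => [|k IH].
  have -> : t_power N 0 = mone by apply/eqP; rewrite fmP fm1.
  by rewrite mul1m mulm1; apply: congruent_refl.
rewrite -add1n t_powerD; apply: congruent_trans (_ : congruent _
  (t_power N 1 · xword (fmu i) · t_power N k)) _.
  by have := congruent_mul (t_power N 1) mone IH; rewrite !mulm1 !mulmA.
by have := congruent_mul mone (t_power N k) (congruent_swap1 i); rewrite !mul1m !mulmA.
Qed.

Lemma congruent_t_power k (n : X) :
  congruent (t_power N k · xword n) (xword n · t_power N k).
Proof.
rewrite -(fmK n); elim: (n : seq _) => [|i s IH].
  have -> : xword (FMonom [::]) = mone :> W by apply/eqP; rewrite fmP fm1.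
  by rewrite mul1m mulm1; apply: congruent_refl.
have -> : xword (FMonom (i :: s)) = xword (fmu i) · xword (FMonom s).
  by apply/eqP; rewrite fmP fmM /= fmU.
apply: congruent_trans (_ : congruent _
  (xword (fmu i) · t_power N k · xword (FMonom s))) _.
  have := congruent_mul mone (xword (FMonom s)) (congruent_t_power_x k i).
  by rewrite !mul1m !mulmA.
by have := congruent_mul (xword (fmu i)) mone IH; rewrite !mulm1 !mulmA.
Qed.

(** That is, f^* t^k is in the ideal generated by G for all large k. Requiring it
in all large degrees makes the condition additive. *)
Definition homogenizes_in (f : F) : Prop := exists D0, forall D, (D0 <= D)%N ->
  Span (@word_lt N) G (fun=> True) (homog_at D f).

(** Multiplying the homogenization of f by words on both sides leaves the power of
t in the middle; it is moved to the right modulo the commutators. *)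
Lemma homogenizes_in_sandwich (u v : X) f :
  homogenizes_in f -> homogenizes_in (sandwich u v f).
Proof.
move=> [D0 h]; exists (D0 + size u + size v)%N => D le.
pose D' := (D - size u - size v)%N.
have sp : Span (@word_lt N) G (fun=> True) (sandwich (xword u) (xword v) (homog_at D' f)).
  by apply: Span_sandwich (h D' _) => //; rewrite /D'; lia.
rewrite /homog_at /sandwich relabel_comp.
move: sp; rewrite /homog_at /sandwich relabel_comp; set s := (_ \o _) => sp; set t := (_ \o _).
have -> : relabel t f = relabel s f - (relabel s f - relabel t f).
  by rewrite opprB addrCA subrr addr0.
apply: (SpanB sp); rewrite relabel_diff; apply: Span_sum => n _; apply: SpanZ.
rewrite /s /t /= /pad_word !fmM !size_cat; set k := (D' - size n)%N.
have -> : (D - (size u + size n + size v) = k)%N by rewrite /k /D'; lia.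
have := congruent_mul (xword u · xword n) mone (congruent_t_power k v).
by rewrite !xwordM !mulm1 !mulmA.
Qed.

Lemma homogenizes_in_ideal : ideal homogenizes_in.
Proof.
have JD f g : homogenizes_in f -> homogenizes_in g -> homogenizes_in (f + g).
  move=> [D1 h1] [D2 h2]; exists (maxn D1 D2) => D; rewrite geq_max => /andP[le1 le2].
  by rewrite /homog_at relabelD; apply: SpanD; [exact: h1 | exact: h2].
have JZ c f : homogenizes_in f -> homogenizes_in (c *: f).
  by move=> [D0 h]; exists D0 => D /h; rewrite /homog_at relabelZ; apply: SpanZ.
have J0 : homogenizes_in 0 by exists 0%N => D _; rewrite /homog_at relabel0; left.
split=> // a f b Jf; rewrite mul_sandwich_sum.
apply: (big_ind homogenizes_in) => // u _.
apply: (big_ind homogenizes_in) => // v _.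
exact/JZ/homogenizes_in_sandwich.
Qed.

End Commutation.

(** A monomial of g either contains t, and then becomes shorter than the leading
one, or has no t and is unchanged; so the leading word stays the largest. *)
Lemma lm_phi d (g : Fbar) : g <> 0 -> homogeneous d g -> all isSome (lmw g) ->
  phi g <> 0 /\ lmF (phi g) = erase_t (lmw g).
Proof.
move=> g0 gh gX; have lg := lm_supp (@word_lt_ordering N) g0.
have xstrip (w : W) : all isSome w -> xword (erase_t w) = w.
  move=> wX; apply/eqP; rewrite fmP /=; apply/eqP.
  by elim: (w : seq _) wX => //= -[y|] s IH //= /IH ->.
have sizeS (w : W) : size (erase_t w) = count isSome w by rewrite /= size_pmap.
have sizeX (w : W) : all isSome w -> size (erase_t w) = size w.
  by rewrite sizeS all_count => /eqP.
have coef : (phi g)@_(erase_t (lmw g)) = g@_(lmw g).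
  rewrite phiE; apply: (mcoeff_relabel (s := @erase_t N)) => n ng e.
  have nX : all isSome n.
    by rewrite all_count -sizeS e sizeX // (gh _ ng) (gh _ lg).
  by rewrite -(xstrip _ nX) e xstrip.
have sg : erase_t (lmw g) \in msupp (phi g) by rewrite -mcoeff_neq0 coef mcoeff_neq0.
split; first by move=> e; move: sg; rewrite e msupp0 inE.
apply: (lmw_unique (@grrlex_ordering N)) => // m.
rewrite phiE => /msupp_relabel [n ng ->] ne.
have [nX|nX] := boolP (all isSome n); last first.
  left; rewrite !fdegE (sizeX _ gX) (gh _ lg) -(gh _ ng) sizeS.
  by rewrite ltn_neqAle count_size andbT -all_count.
case: (grrlex_ordering N) => _ _ tot _ _; case: (tot _ _ ne) => // lt_mn.
have padE (w : W) : w \in msupp g -> all isSome w -> pad_word d (erase_t w) = w.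
  move=> wg wX; rewrite /pad_word (sizeX _ wX) (gh _ wg) subnn xstrip //.
  by rewrite (_ : t_power N 0 = mone) ?mulm1 //; apply/eqP; rewrite fmP fm1.
have := pad_lt (D := d) _ lt_mn; rewrite (sizeX _ nX) (gh _ ng) leqnn => /(_ isT).
rewrite !padE // => lt_lm; case: (lm_max (@word_lt_ordering N) g0 ng) => [e|].
  by case: ne; rewrite -e.
by move/(monomial_ordering_asym (@word_lt_ordering N) lt_lm).
Qed.

Lemma pad_no_tx D (n : X) (u v : W) i :
  pad_word D n <> u · FMonom [:: None; Some i] · v.
Proof.
move=> /(congr1 (@fmonom_val A)); rewrite !fmM -catA /= => e.
have e1 : nth None (map Some n ++ nseq (D - size n) None) (size u) = None.
  by rewrite e nth_cat ltnn subnn.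
have : nth None (map Some n ++ nseq (D - size n) None) (size u).+1 = Some i.
  by rewrite e nth_cat ltnNge leqnSn /= subSnn.
rewrite nth_cat size_map; case: ltnP => [lt_u|_]; last by rewrite nth_nseq if_same.
move: e1; rewrite nth_cat size_map (ltnW lt_u).
by rewrite (nth_map i) // ltnW.
Qed.
End Dehomogenization.

(** * Correctness of the algorithm *)

Section Correctness.
Local Open Scope ring_scope.
Local Open Scope classical_set_scope.
Variables (K : fieldType) (N : option nat).
Local Notation X := {fmonom (xvar N)}.
Local Notation F := 'F[K, N].
Local Notation Fbar := 'Fbar[K, N].
Local Notation lmw := (lm (@word_lt N)).
Local Notation lmF := (lm (@grrlex_lt N)).
Local Notation "u · v" := (mmul u v) (at level 40, left associativity).
Variables (I H : set F) (idealI : ideal I) (H_basis : I = ideal_gen H).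

Lemma ideal_gen_sub (f : F) : H f -> I f.
Proof. by move=> Hf; rewrite H_basis => J _; apply. Qed.

Lemma homog_admissible f : I f -> f <> 0 -> admissible I (homog f).
Proof.
move=> If f0; rewrite homogE; split.
- exact: homog_at_neq0.
- by exists (topdeg f); apply: homog_at_homogeneous => n; apply: topdeg_ge.
- left; rewrite lm_homog_at //; last by move=> n; apply: topdeg_ge.
  have -> : pad_word (topdeg f) (lmF f) = xword (lmF f) · t_power N 0.
    rewrite /pad_word; congr (_ · t_power N _); apply/eqP; rewrite subn_eq0.
    apply/bigmax_leqP_seq => n nf _.
    case: (lm_max (@grrlex_ordering N) f0 nf) => [->//|[/ltnW//|[+ _]]].
    by rewrite !fdegE => ->.
  by rewrite fmM /= cats0; apply/allP => y /mapP[i _ ->].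
- by rewrite phi_homog_at.
Qed.

Lemma initial_basis :
  basis_invariant I (homog_set H `|` @t_commutators K N).
Proof.
split=> [g [[f [Hf f0] <-]|[i _ <-]]|i]; last by right; exists i.
  by apply: homog_admissible => //; exact: ideal_gen_sub.
split.
- exact: t_commutator_neq0.
- by exists 2%N; exact: t_commutator_homogeneous.
- by right; exists i.
- by have := phi_t_commutator K i; rewrite /t_commutator => ->; case: idealI.
Qed.

(** The elements that homogenize into the ideal generated by G form an ideal that
contains H. *)
Lemma homogenizes_basis (G : set Fbar) f : (forall i, G (t_commutator K i)) ->
  homog_set H `<=` G -> I f -> homogenizes_in G f.
Proof.
move=> Gt HG; rewrite H_basis => /(_ _ (homogenizes_in_ideal Gt)); apply=> g Hg.
have [->|/eqP g0] := eqVneq g 0.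
  by exists 0%N => D _; rewrite /homog_at relabel0; left.
exists (topdeg g) => D le.
have -> : homog_at D g = 1 *: sandwich mone (t_power N (D - topdeg g)) (homog g).
  rewrite scale1r homogE /homog_at /sandwich relabel_comp; apply: eq_relabel => n ng /=.
  rewrite mul1m /pad_word -mulmA -t_powerD; congr (_ · t_power N _).
  by have := topdeg_ge ng; lia.
by apply: Span_gen => //; apply: HG; exists g.
Qed.

Lemma dehomogenized_basis (G : set Fbar) : basis_invariant I G ->
  homog_set H `<=` G ->
  (forall g g', G g -> G g' -> overlap_resolved (@word_lt N) G g g') ->
  groebner_basis (@grrlex_lt N) I (@phi K N @` G).
Proof.
move=> [adm Gt] HG res; split; first by move=> _ [g /adm[_ _ _ Ig] <-].
move=> f If f0; have [D0 sp] := homogenizes_basis Gt HG If.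
pose D := maxn D0 (topdeg f).
have small (n : X) : n \in msupp f -> (size n <= D)%N.
  by move=> nf; rewrite leq_max topdeg_ge ?orbT.
have G0 (g : Fbar) : G g -> g <> 0 by move=> /adm[].
have [g Gg [u [v e]]] := diamond (@word_lt_ordering N) (@word_equidivisible N) G0 res
  (sp D (leq_maxl _ _)) (homog_at_neq0 f0).
rewrite lm_homog_at // in e; have [g0 [d gh] gX _] := adm _ Gg.
have {}gX : all isSome (lmw g).
  case: gX => // -[i gE]; rewrite gE lm_t_commutator in e.
  by have := pad_no_tx e.
have [pg0 pgE] := lm_phi g0 gh gX.
exists (phi g); first by split=> //; exists g.
exists (erase_t u), (erase_t v); rewrite pgE -!erase_tM.
have := congr1 (@erase_t N) e; rewrite erase_t_pad; exact.
Qed.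
End Correctness.

Theorem theorem5p13 (K : fieldType) (N : option nat)
  (lt : {cmonom xtvar N} -> {cmonom xtvar N} -> Prop)
  (lt_ordering : monomial_ordering lt) (lt_variables : ordered_variables lt)
  (I H : set 'F[K, N]) (idealI : ideal I) (H_basis : I = ideal_gen H)
  (O : set 'F[K, N]) (terminates : FreeGBasis lt H O) :
  groebner_basis (@grrlex_lt N) I O.
Proof.
case: terminates => R loop ->.
have inv := initial_basis idealI H_basis.
have [|||G [Ginv RE GG res]] :=
  main_loop_invariant lt_ordering lt_variables idealI loop inv.
- by [].
- by move=> p.
- move=> g g' Gg Gg'; left; split.
    by exists g; [exact: Gg | exact: erefl].
  by exists g'; [exact: Gg' | exact: erefl].
have -> : (@letterplace K N @^-1` R)%classic = G.
  rewrite RE; apply/seteqP; split=> [g [g' Gg' /letterplace_inj <- //]|g Gg].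
  by exists g; [exact: Gg | exact: erefl].
apply: (dehomogenized_basis H_basis Ginv) => //.
by move=> g Hg; apply: GG; left.
Qed.
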